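(* For all integers $c\geq 0$ and $n\geq 0$, \begin{align*} d_{25c+16}(25n+8)&\equiv 0\pmod{5},\\ d_{25c+8}(5n+1)&\equiv 0\pmod{25},\\ d_{25c+k}(25n+24-k)&\equiv 0\pmod{25}\quad\text{for each } k\in\{0,5,10\}. \end{align*}
   Context: For a positive integer $m$ and $|q|<1$, let $f_m:=\prod_{n\geq 1}(1-q^{mn})$. For each integer $k\geq 0$, the numbers $d_k(n)$ ($n\geq 0$) are defined by the generating function $\sum_{n\geq 0} d_k(n)q^n = \dfrac{f_2^k}{f_1^{3k+1}}$ (for $k\ge1$, $d_k(n)$ counts partitions obtained by summing the links of $k$-elongated partition diamonds of length $n$; $d_0(n)$ is the ordinary partition function $p(n)$). *)

(* Defs.v *)
(* Formal power series over the integers: everything is read formally in q, *)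
(* with a series represented by its sequence of coefficients.               *)
From mathcomp Require Import all_boot all_order all_algebra.
Set Implicit Arguments.
Unset Strict Implicit.
Unset Printing Implicit Defensive.
Import Order.TTheory GRing.Theory Num.Theory.
Local Open Scope ring_scope.

Definition fps := nat -> int.

Definition fps_one : fps := fun n => (n == 0)%N%:R.

Definition fps_mul (a b : fps) : fps :=
  fun n => \sum_(i < n.+1) a i * b (n - i)%N.

Definition fps_exp (a : fps) (m : nat) : fps := iter m (fps_mul a) fps_one.

(* The first n coefficients of the inverse of a series with constant term 1. *)
Fixpoint fps_inv_seq (a : fps) (n : nat) : seq int :=
  if n is n'.+1 then
    let s := fps_inv_seq a n' in
    rcons s ((n' == 0)%N%:R - \sum_(i < n') a i.+1 * s`_(n' - i.+1))
  else [::].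

(* Meaningful only when a 0 = 1; see fps_mulV. *)
Definition fps_inv (a : fps) : fps := fun n => (fps_inv_seq a n.+1)`_n.

Definition fps_div (a b : fps) : fps := fps_mul a (fps_inv b).

(* f_m = prod_(i >= 1) (1 - q^(m i)).  For m >= 1 the factors with i > n do  *)
(* not affect the coefficient of q^n; see euler_f_stable.                    *)
Definition euler_f (m : nat) : fps :=
  fun n => (\prod_(1 <= i < n.+1) (1 - 'X^(m * i)) : {poly int})`_n.

Definition d (k : nat) : fps :=
  fps_div (fps_exp (euler_f 2) k) (fps_exp (euler_f 1) (3 * k + 1)).

Lemma size_fps_inv_seq a n : size (fps_inv_seq a n) = n.
Proof. by elim: n => //= n IHn; rewrite size_rcons IHn. Qed.

Lemma nth_fps_inv_seq a n i : (i < n)%N -> (fps_inv_seq a n)`_i = fps_inv a i.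
Proof.
elim: n => // n IHn; rewrite ltnS leq_eqVlt => /orP[/eqP-> //|lt_in].
by rewrite /= nth_rcons size_fps_inv_seq lt_in IHn.
Qed.

Lemma fps_invE a n :
  fps_inv a n = (n == 0)%N%:R - \sum_(i < n) a i.+1 * fps_inv a (n - i.+1)%N.
Proof.
rewrite {1}/fps_inv /= nth_rcons size_fps_inv_seq ltnn eqxx.
congr (_ - _); apply: eq_bigr => i _; rewrite nth_fps_inv_seq //.
by rewrite ltn_subrL /=; apply: leq_ltn_trans (ltn_ord i).
Qed.

Lemma fps_mulV a : a 0%N = 1 -> fps_mul a (fps_inv a) =1 fps_one.
Proof.
move=> a0 n; rewrite /fps_mul big_ord_recl a0 mul1r subn0.
by rewrite [fps_inv a n]fps_invE subrK.
Qed.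

Lemma euler_f_stable m n N : (0 < m)%N -> (n <= N)%N ->
  (\prod_(1 <= i < N.+1) (1 - 'X^(m * i)) : {poly int})`_n = euler_f m n.
Proof.
move=> m_gt0; elim: N => [|N IHN]; first by rewrite leqn0 => /eqP->.
rewrite leq_eqVlt => /orP[/eqP-> //|]; rewrite ltnS => le_nN.
rewrite big_nat_recr //= mulrBr mulr1 coefB coefMXn IHN //.
have -> : (n < m * N.+1)%N by rewrite (@leq_trans N.+1) // leq_pmull.
by rewrite subr0.
Qed.

Lemma euler_f0 m : euler_f m 0 = 1.
Proof. by rewrite /euler_f big_geq // coef1. Qed.

Lemma fps_exp0 a m : a 0%N = 1 -> fps_exp a m 0%N = 1.
Proof.
move=> a0; elim: m => //= m IHm.
by rewrite /fps_mul big_ord1 a0 mul1r subnn.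
Qed.

Lemma fps_exp_euler_fV m j :
  fps_mul (fps_exp (euler_f m) j) (fps_inv (fps_exp (euler_f m) j)) =1 fps_one.
Proof. exact/fps_mulV/fps_exp0/euler_f0. Qed.

(* Main.v *)
(* Write f_m for the Euler products, V for q -> q^5, and let U_r extract the
   coefficients of index 5n + r.  The pentagonal number theorem and Gauss's sum
   for phi(-q) = f_1^2/f_2 show which U_r vanish on f_1 and on f_1^2/f_2.  They
   give f_1 = f_25 (VA - q - q^2/VA) and f_2 = f_50 (VB - q^2 - q^4/VB), where B
   is A at q^2, and, comparing the five sections of f_1^2 = f_2 phi, the relation
   A B^2 (A^2 - B) = q (A^2 + B).

   By f^25 = V(f^5) modulo 25, each claim is about a section of some f_2^i f_1^j,
   which is f_5 and f_10 powers times a Laurent polynomial in A, B, q.  For the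
   first two claims use U_3(f_1 f_2) = f_5 f_10 with U_1(f_2^3) = 5 q f_10^3, and
   U_1(f_2^8) = -125 q^3 f_10^8.  For the last one,
   U_4(f_2^5i f_1^(5j+4)) is 5 times a series known modulo 5, which is brought
   back to the form (series in q^5) f_1^a f_2^b by f_1 = f_5^5 (A^5 - q - q^2/A^5)
   modulo 5 (and the same for f_2): the Laurent polynomial L = [lser] that occurs
   satisfies L^3 = 1/(f_1 f_2)^24 modulo 5, so L = 1/(f_1 f_2)^8. *)
From HB Require Import structures.
Require Import Defs.
From mathcomp Require Import all_boot all_order all_algebra.
From mathcomp Require Import boolp ring zify.
From Stdlib Require Import Setoid.
Import Order.TTheory GRing.Theory Num.Theory.
Set Implicit Arguments.
Unset Strict Implicit.
Unset Printing Implicit Defensive.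
Local Open Scope ring_scope.

(** * The commutative ring of formal power series over the integers *)

Record pser := Pser { pcoef :> nat -> int }.

HB.instance Definition _ := gen_eqMixin pser.
HB.instance Definition _ := gen_choiceMixin pser.

Lemma pserP (x y : pser) : x =1 y -> x = y.
Proof. by case: x y => [x] [y] /= /funext->. Qed.

Definition padd (x y : pser) := Pser (fun n => x n + y n).
Definition popp (x : pser) := Pser (fun n => - x n).
Definition pzero := Pser (fun => 0).
Definition pmul (x y : pser) := Pser (fps_mul x y).
Definition pone := Pser fps_one.

Fact paddA : associative padd.
Proof. by move=> x y z; apply: pserP => n /=; rewrite addrA. Qed.
Fact paddC : commutative padd.
Proof. by move=> x y; apply: pserP => n /=; rewrite addrC. Qed.
Fact padd0 : left_id pzero padd.
Proof. by move=> x; apply: pserP => n /=; rewrite add0r. Qed.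
Fact paddN : left_inverse pzero popp padd.
Proof. by move=> x; apply: pserP => n /=; rewrite addNr. Qed.

HB.instance Definition _ := GRing.isZmodule.Build pser paddA paddC padd0 paddN.

(** Coefficients of a product below [N] depend only on the truncations at [N], so the ring laws and
    the multiplicativity of [dil] can be taken from polynomials. *)
Definition trunc N (x : pser) : {poly int} := \poly_(i < N) x i.

Lemma coef_trunc N x i : (i < N)%N -> (trunc N x)`_i = x i.
Proof. by move=> lt_iN; rewrite coef_poly lt_iN. Qed.

Lemma coef_pmul N (x y : pser) n : (n < N)%N ->
  pmul x y n = (trunc N x * trunc N y)`_n.
Proof.
move=> lt_nN; rewrite coefM; apply: eq_bigr => i _.
by rewrite !coef_trunc //; have := ltn_ord i; lia.
Qed.

Fact pmulA : associative pmul.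
Proof.
move=> x y z; apply: pserP => n.
have E u v w : pmul (pmul u v) w n = (trunc n.+1 u * trunc n.+1 v * trunc n.+1 w)`_n.
  rewrite coefM; apply: eq_bigr => i _; rewrite (@coef_pmul n.+1) //.
  by rewrite coef_trunc //; have := ltn_ord i; lia.
have pmulC u v : pmul u v n = pmul v u n by rewrite !(@coef_pmul n.+1) // mulrC.
by rewrite pmulC !E -[in RHS]mulrA [in RHS]mulrC.
Qed.
Fact pmulC : commutative pmul.
Proof. by move=> x y; apply: pserP => n; rewrite !(@coef_pmul n.+1) // mulrC. Qed.
Fact pmul1 : left_id pone pmul.
Proof.
move=> x; apply: pserP => n /=; rewrite /fps_mul big_ord_recl mul1r subn0.
by rewrite big1 ?addr0 // => i _; rewrite mul0r.
Qed.
Fact pmulDl : left_distributive pmul +%R.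
Proof.
move=> x y z; apply: pserP => n /=; rewrite /fps_mul -big_split /=.
by apply: eq_bigr => i _; rewrite mulrDl.
Qed.
Fact pone_neq0 : pone != 0.
Proof. by apply/eqP => /(congr1 (fun x : pser => x 0%N)). Qed.

HB.instance Definition _ :=
  GRing.Zmodule_isComNzRing.Build pser pmulA pmulC pmul1 pmulDl pone_neq0.

Lemma pcoefD (x y : pser) n : (x + y) n = x n + y n. Proof. by []. Qed.
Lemma pcoefN (x : pser) n : (- x) n = - x n. Proof. by []. Qed.
Lemma pcoefMn (x : pser) k n : (x *+ k) n = x n *+ k.
Proof. by elim: k => // k IHk; rewrite !mulrS pcoefD IHk. Qed.
Lemma pcoef_sum I (r : seq I) (P : pred I) (G : I -> pser) n :
  (\sum_(i <- r | P i) G i) n = \sum_(i <- r | P i) G i n.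
Proof. by elim/big_rec2: _ => // i y x _ <-. Qed.
Lemma pcoefM0 (x y : pser) : (x * y) 0%N = x 0%N * y 0%N.
Proof. by rewrite /= /fps_mul big_ord1. Qed.
Lemma pcoefX0 (x : pser) k : x 0%N = 1 -> (x ^+ k) 0%N = 1.
Proof. by move=> x0; elim: k => // k IHk; rewrite exprS pcoefM0 x0 IHk. Qed.

Lemma pexpE (x : pser) k : x ^+ k = Pser (fps_exp x k).
Proof. by elim: k => // k IHk; rewrite exprS IHk. Qed.

Definition pinv (x : pser) := Pser (fps_inv x).

Lemma pmulV (x : pser) : x 0%N = 1 -> x * pinv x = 1.
Proof. by move=> x0; apply: pserP => n; rewrite -[RHS](fps_mulV x0). Qed.

Lemma pinv0 (x : pser) : pinv x 0%N = 1.
Proof. by rewrite /= fps_invE big_ord0 subr0. Qed.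

(** * The variable q, dilations and five-sections *)

Definition pX := Pser (fun n => (n == 1)%N%:R).
Local Notation q := pX.

Lemma pcoefXM k (x : pser) n :
  (q ^+ k * x) n = if (n < k)%N then 0 else x (n - k)%N.
Proof.
elim: k n => [|k IHk] n; first by rewrite mul1r subn0.
rewrite exprS -mulrA; case: n => [|n]; first by rewrite pcoefM0 mul0r.
rewrite [LHS]big_ord_recl mul0r add0r big_ord_recl mul1r subn1 -pred_Sn [X in X + _]IHk.
by rewrite big1 ?addr0 // => i _; rewrite mul0r.
Qed.

Lemma pcoefXn k n : (q ^+ k) n = (n == k)%:R.
Proof. by rewrite -[q ^+ k]mulr1 pcoefXM /= /fps_one; case: ltngtP; lia. Qed.

(* The substitution q -> q^m; m = 0 is read as m = 1, which makes it a ring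
   morphism for every m. *)
Definition dil m (x : pser) :=
  Pser (fun n => if (m.-1.+1 %| n)%N then x (n %/ m.-1.+1)%N else 0).

Lemma dil_trunc N m x n : (n < N)%N -> dil m x n = (trunc N x \Po 'X^(m.-1.+1))`_n.
Proof.
move=> lt_nN; rewrite coef_comp_poly_Xn //=; case: ifP => // _.
by rewrite coef_trunc // (leq_ltn_trans (leq_div _ _)).
Qed.

Fact dil_is_zmod_morphism m : zmod_morphism (dil m).
Proof.
move=> x y; apply: pserP => n; rewrite pcoefD pcoefN /=.
by case: ifP; rewrite ?subr0.
Qed.
Fact dil_is_monoid_morphism m : monoid_morphism (dil m).
Proof.
split=> [|x y]; apply: pserP => n.
  rewrite /= /fps_one; case: ifP => [/dvdnP[k ->]|]; last by case: n.
  by rewrite mulnK // muln_eq0 orbF.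
rewrite [RHS](@coef_pmul n.+1) // (@dil_trunc n.+1) //.
have E u i : (i < n.+1)%N -> (trunc n.+1 (dil m u))`_i = (trunc n.+1 u \Po 'X^(m.-1.+1))`_i.
  by move=> lt_in; rewrite coef_trunc // (@dil_trunc n.+1).
rewrite coefM (eq_bigr (fun i : 'I_n.+1 => (trunc n.+1 x \Po 'X^(m.-1.+1))`_i *
   (trunc n.+1 y \Po 'X^(m.-1.+1))`_(n - i))); last first.
  by move=> i _; rewrite !E //; have := ltn_ord i; lia.
rewrite -coefM -comp_polyM !coef_comp_poly_Xn //; case: ifP => // _.
set k := (n %/ _)%N; have lt_kn : (k < n.+1)%N by rewrite ltnS leq_div.
by rewrite coef_trunc // -coef_pmul.
Qed.
HB.instance Definition _ m := GRing.isZmodMorphism.Build pser pser (dil m) (@dil_is_zmod_morphism m).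
HB.instance Definition _ m := GRing.isMonoidMorphism.Build pser pser (dil m) (@dil_is_monoid_morphism m).

Lemma dilX m : (0 < m)%N -> dil m q = q ^+ m.
Proof.
case: m => // m _; apply: pserP => n; rewrite pcoefXn /=.
case: ifP => [/dvdnP[k ->]|ndvd]; first by rewrite mulnK // -{2}[m.+1]mul1n eqn_pmul2r.
by case: eqP ndvd => // ->; rewrite dvdnn.
Qed.

Lemma dil_dil m n x : (0 < m)%N -> (0 < n)%N -> dil m (dil n x) = dil (m * n) x.
Proof.
case: m n => [|m] [|n] // _ _; apply: pserP => k /=.
rewrite -[(m.+1 * n.+1).-1.+1]/(m.+1 * n.+1)%N.
have [/dvdnP[j ->]|ndvd] := boolP (m.+1 %| k)%N.
  by rewrite mulnK // [(m.+1 * _)%N]mulnC dvdn_pmul2r // divnMr.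
by case: ifP => // /(dvdn_trans (dvdn_mulr _ (dvdnn _))); rewrite (negPf ndvd).
Qed.

Lemma dilC m n x : (0 < m)%N -> (0 < n)%N -> dil m (dil n x) = dil n (dil m x).
Proof. by move=> m0 n0; rewrite !dil_dil // mulnC. Qed.

(** The operator U_r; the operator V is [dil 5]. *)
Definition sec r (x : pser) := Pser (fun n => x (5 * n + r)%N).

Fact sec_is_zmod_morphism r : zmod_morphism (sec r).
Proof. by move=> x y; apply: pserP. Qed.
HB.instance Definition _ r := GRing.isZmodMorphism.Build pser pser (sec r) (@sec_is_zmod_morphism r).

Lemma secXdil r s x : (r < 5)%N -> (s < 5)%N ->
  sec r (q ^+ s * dil 5 x) = if r == s then x else 0.
Proof.
move=> lt_r5 lt_s5; apply: pserP => n; rewrite [LHS]pcoefXM /=.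
case: eqP => [->|ne_rs]; last first.
  by case: ifP => // le_s; case: ifP => // /dvdnP[k Ek]; exfalso; lia.
rewrite ifF; last by apply/negbTE; rewrite -leqNgt leq_addl.
by rewrite addnK dvdn_mulr // mulKn.
Qed.

Lemma dissection x : x = \sum_(s < 5) q ^+ s * dil 5 (sec s x).
Proof.
apply: pserP => n; rewrite pcoef_sum.
have lt5 : (n %% 5 < 5)%N by rewrite ltn_mod.
rewrite (bigD1 (Ordinal lt5)) // big1 => [|s ne_s]; last first.
  rewrite pcoefXM; case: ifP => // le_sn /=.
  case: ifP => // /dvdnP[k Ek]; case/eqP: ne_s; apply: val_inj => /=.
  by have := ltn_ord s; lia.
rewrite [RHS]addr0 [RHS]pcoefXM ltnNge leq_mod /=.
have -> : (n - n %% 5 = 5 * (n %/ 5))%N by lia.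
by rewrite dvdn_mulr // mulKn // [(5 * _)%N]mulnC -divn_eq.
Qed.

Lemma sec_dissect r (u : nat -> pser) : (r < 5)%N ->
  sec r (\sum_(s < 5) q ^+ s * dil 5 (u s)) = u r.
Proof.
move=> lt_r5; rewrite raddf_sum (bigD1 (Ordinal lt_r5)) //= secXdil // eqxx.
rewrite big1 ?addr0 // => s ne_s; rewrite secXdil // ifN //.
by apply: contraNN ne_s => /eqP rs; apply/eqP/val_inj.
Qed.

(** A five-section is unique, so the sections can be read off any explicit decomposition; the
    computations below supply one and leave a [ring] identity. *)
Lemma sec5E x u0 u1 u2 u3 u4 :
  x = dil 5 u0 + q * dil 5 u1 + q ^+ 2 * dil 5 u2 + q ^+ 3 * dil 5 u3 + q ^+ 4 * dil 5 u4 ->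
  forall r, (r < 5)%N -> sec r x = nth 0 [:: u0; u1; u2; u3; u4] r.
Proof.
move=> Ex r lt_r5; rewrite -(@sec_dissect r (nth 0 [:: u0; u1; u2; u3; u4])) //.
by congr sec; rewrite Ex !big_ord_recl big_ord0 /=; ring.
Qed.

Lemma sec_dilM r x y : (r < 5)%N -> sec r (dil 5 x * y) = x * sec r y.
Proof.
move=> lt_r5; rewrite {1}[y]dissection mulr_sumr.
rewrite (eq_bigr (fun s : 'I_5 => q ^+ s * dil 5 (x * sec s y))).
  by rewrite (@sec_dissect r (fun s => x * sec s y)).
by move=> s _; rewrite rmorphM mulrCA.
Qed.

Lemma sec_dil0 x : sec 0 (dil 5 x) = x.
Proof. by have := @secXdil 0 0 x isT isT; rewrite mul1r. Qed.

(** * Congruences between series *)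

(** For [m] = 5 or 25 this is coefficientwise congruence, for [m] = q^n it is agreement of the first
    n coefficients. *)
Definition cong (m x y : pser) := exists z, x = y + m * z.

Lemma cong_refl m x : cong m x x.
Proof. by exists 0; rewrite mulr0 addr0. Qed.

Lemma cong_sym m x y : cong m x y -> cong m y x.
Proof. by case=> z ->; exists (- z); ring. Qed.

Lemma cong_trans m x y z : cong m x y -> cong m y z -> cong m x z.
Proof. by case=> u -> [v ->]; exists (u + v); ring. Qed.

Lemma congD m x x' y y' : cong m x x' -> cong m y y' -> cong m (x + y) (x' + y').
Proof. by case=> u -> [v ->]; exists (u + v); ring. Qed.

Lemma congN m x x' : cong m x x' -> cong m (- x) (- x').
Proof. by case=> u ->; exists (- u); ring. Qed.

Lemma congM m x x' y y' : cong m x x' -> cong m y y' -> cong m (x * y) (x' * y').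
Proof. by case=> u -> [v ->]; exists (u * y' + x' * v + m * u * v); ring. Qed.

Lemma congX m x x' k : cong m x x' -> cong m (x ^+ k) (x' ^+ k).
Proof.
move=> cx; elim: k => [|k IHk]; first exact: cong_refl.
by rewrite !exprS; apply: congM.
Qed.

Add Parametric Relation m : pser (cong m)
  reflexivity proved by (@cong_refl m)
  symmetry proved by (@cong_sym m)
  transitivity proved by (@cong_trans m) as cong_equivalence.

Add Parametric Morphism m : (@GRing.add pser) with signature
  cong m ==> cong m ==> cong m as cong_add_morphism.
Proof. by move=> x x' cx y y' cy; apply: congD. Qed.

Add Parametric Morphism m : (@GRing.opp pser) with signature
  cong m ==> cong m as cong_opp_morphism.
Proof. exact: congN. Qed.

Add Parametric Morphism m : (@GRing.mul pser) with signature
  cong m ==> cong m ==> cong m as cong_mul_morphism.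
Proof. by move=> x x' cx y y' cy; apply: congM. Qed.

Add Parametric Morphism m : (@GRing.exp pser) with signature
  cong m ==> eq ==> cong m as cong_exp_morphism.
Proof. by move=> x x' cx k; apply: congX. Qed.

Lemma cong_factor m k x y : cong (m * k) x y -> cong m x y.
Proof. by case=> z ->; exists (k * z); rewrite mulrA. Qed.

Lemma cong_sum m n (G H : 'I_n -> pser) :
  (forall i, cong m (G i) (H i)) -> cong m (\sum_i G i) (\sum_i H i).
Proof.
move=> cGH; elim/big_ind2: _ => // [|x x' y y' cx cy]; first exact: cong_refl.
exact: congD.
Qed.

Lemma cong_unit_cancel m (u x y : pser) : u 0%N = 1 -> cong m (u * x) (u * y) -> cong m x y.
Proof.
move=> u0 [z Ez]; exists (pinv u * z).
have E w : w = pinv u * (u * w) by rewrite mulrA [pinv u * _]mulrC pmulV // mul1r.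
by rewrite (E x) Ez mulrDr -(E y) mulrCA.
Qed.

Lemma congXnP n (x y : pser) : (forall i, (i < n)%N -> x i = y i) <-> cong (q ^+ n) x y.
Proof.
split=> [Exy|[z ->] i lt_in]; last by rewrite pcoefD pcoefXM lt_in addr0.
exists (Pser (fun i => (x - y) (n + i)%N)); apply: pserP => i.
rewrite pcoefD pcoefXM; case: ltnP => [/Exy->|le_ni]; first by rewrite addr0.
by rewrite /= subnKC // addrC subrK.
Qed.

Lemma congXn_le k n x y : (k <= n)%N -> cong (q ^+ n) x y -> cong (q ^+ k) x y.
Proof. by move=> le_kn; rewrite -(subnKC le_kn) exprD; apply: cong_factor. Qed.

Lemma congXn_mul k n x y : cong (q ^+ n) x y ->
  cong (q ^+ (k + n)) (q ^+ k * x) (q ^+ k * y).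
Proof. by case=> z ->; exists z; rewrite exprD; ring. Qed.

Lemma congXn_eq x y : (forall n, cong (q ^+ n) x y) -> x = y.
Proof. by move=> cxy; apply: pserP => n; apply: (congXnP n.+1 x y).2. Qed.

Lemma mulXn_inj n x y : q ^+ n * x = q ^+ n * y -> x = y.
Proof.
move=> Exy; apply: pserP => i.
have := congr1 (fun z : pser => z (n + i)%N) Exy.
by rewrite !pcoefXM ltnNge leq_addr /= addKn.
Qed.

Lemma dil_cong m k x y : (0 < m)%N -> cong (q ^+ k) x y ->
  cong (q ^+ (m * k)) (dil m x) (dil m y).
Proof.
move=> m0 [z ->]; exists (dil m z).
by rewrite rmorphD rmorphM rmorphXn /= dilX // exprM.
Qed.

(** * Gaussian binomial coefficients *)

Section QBinomial.

Variables (R : comNzRingType) (p : R).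

(** Gaussian binomials through the q-Pascal rule, which avoids division in [R]; [qfac] is the
    Pochhammer product (p; p)_n. *)
Fixpoint qbin n k : R :=
  match n, k with
  | _, 0 => 1
  | 0, _.+1 => 0
  | n'.+1, k'.+1 => qbin n' k' + p ^+ k * qbin n' k
  end.

Definition qfac n : R := \prod_(i < n) (1 - p ^+ i.+1).

Lemma qbin0 n : qbin n 0 = 1. Proof. by case: n. Qed.

Lemma qbinS n k : qbin n.+1 k.+1 = qbin n k + p ^+ k.+1 * qbin n k.+1.
Proof. by []. Qed.

Lemma qbin_small n k : (n < k)%N -> qbin n k = 0.
Proof.
elim: n k => [|n IHn] [|k] //= lt_nk.
by rewrite !IHn ?mulr0 ?addr0 //; lia.
Qed.

Lemma qbinnn n : qbin n n = 1.
Proof. by elim: n => //= n ->; rewrite qbin_small // mulr0 addr0. Qed.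

Lemma qfacS n : qfac n.+1 = qfac n * (1 - p ^+ n.+1).
Proof. exact: big_ord_recr. Qed.

Lemma qbin_fac i j : qbin (i + j) i * qfac i * qfac j = qfac (i + j).
Proof.
have [n] := ubnP (i + j)%N; elim: n i j => // n IHn [|i] [|j] lt_n.
- by rewrite qbin0 /qfac !big_ord0 !mulr1.
- by rewrite qbin0 /qfac big_ord0 !mul1r.
- by rewrite addn0 qbinnn /qfac big_ord0 mulr1 mul1r.
have E1 := IHn i j.+1 ltac:(lia); have E2 := IHn i.+1 j ltac:(lia).
rewrite addnS (qfacS j) in E1; rewrite addSn (qfacS i) in E2.
rewrite addSn addnS qbinS (qfacS (i + j).+1) (qfacS i) (qfacS j).
have -> : p ^+ (i + j).+2 = p ^+ i.+1 * p ^+ j.+1 by rewrite -exprD addSn addnS.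
(* The splitting 1 - p^(a+b) = (1 - p^a) + p^a (1 - p^b) mirrors the q-Pascal rule, with one
   induction hypothesis for each term. *)
rewrite (_ : qfac (i + j).+1 * _ = (1 - p ^+ i.+1) * qfac (i + j).+1 +
  p ^+ i.+1 * (1 - p ^+ j.+1) * qfac (i + j).+1); last by ring.
by rewrite -{1}E1 -E2; ring.
Qed.

(** Rothe's finite q-binomial theorem. Taking off the first factor leaves the same product with
    [y * p] for [y], hence the induction with [y] general. *)
Lemma qbinomial n x y :
  \prod_(i < n) (x + y * p ^+ i) =
  \sum_(k < n.+1) p ^+ 'C(k, 2) * qbin n k * y ^+ k * x ^+ (n - k).
Proof.
elim: n y => [|n IHn] y.
  by rewrite big_ord0 big_ord1 /= expr0 !mulr1.
rewrite big_ord_recl /= expr0 mulr1.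
rewrite (eq_bigr (fun i : 'I_n => x + (y * p) * p ^+ i)); last first.
  by move=> i _; rewrite /bump /= add1n exprS mulrA.
rewrite IHn mulrDl [RHS]big_ord_recl /= subn0.
rewrite [X in _ = _ + X](eq_bigr (fun k : 'I_n.+1 =>
  y * (p ^+ 'C(k, 2) * qbin n k * (y * p) ^+ k * x ^+ (n - k)) +
  p ^+ 'C(k.+1, 2) * p ^+ k.+1 * qbin n k.+1 * y ^+ k.+1 * x ^+ (n - k))); last first.
  move=> k _; rewrite add0n /bump leq0n add1n subSS binS bin1 addnC exprD exprMn.
  by rewrite [y ^+ k.+1]exprS; ring.
rewrite big_split /= -mulr_sumr addrA [RHS]addrAC; congr (_ + _).
rewrite [in RHS]big_ord_recr /= qbin_small // mulr0 !mul0r addr0.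
rewrite big_ord_recl /= qbin0 subn0 mulrDr; congr (_ + _).
  by rewrite !expr0 !mul1r exprS.
rewrite mulr_sumr; apply: eq_bigr => k _; rewrite /bump /= add1n.
have -> : (n - k = (n - k.+1).+1)%N by have := ltn_ord k; lia.
by rewrite exprMn [x ^+ _.+1]exprS; ring.
Qed.

End QBinomial.

(** * Jacobi's triple product *)

Lemma bin2D a b : ('C(a + b, 2) = 'C(a, 2) + 'C(b, 2) + a * b)%N.
Proof. by elim: a => [|a IHa]; rewrite ?addSn ?binS ?bin1 ?IHa ?add0n //; lia. Qed.

Lemma bin2_double a : ('C(a, 2) * 2 + a = a * a)%N.
Proof. by elim: a => // a; rewrite binS bin1; lia. Qed.

(* The exponent [m j (j - 1) / 2 + r j] for the integer [j = k - n]. *)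
Definition jexp m r n k :=
  if (n <= k)%N then (m * 'C(k - n, 2) + r * (k - n))%N
  else (m * 'C(n - k, 2) + (m - r) * (n - k))%N.

(** Recentres the q-binomial theorem in base q^m with x = q^(mn - r), y = -1 and 2n factors: up to a
    constant, the exponent of the k-th term is the quadratic one in k - n. *)
Lemma jexpE m r n k : (0 < n)%N -> (r <= m)%N -> (k <= n + n)%N ->
  (m * 'C(k, 2) + (m * n - r) * (n + n - k) =
   m * 'C(n, 2) + n * (m * n - r) + jexp m r n k)%N.
Proof.
move=> n0 le_rm le_k; rewrite /jexp; have le_rmn : (r <= m * n)%N by nia.
have [x Ex] : exists x, (m * n = x + r)%N by exists (m * n - r)%N; lia.
rewrite Ex addnK; case: leqP => [/subnKC|/ltnW/subnKC] E.
  set t := (k - n)%N in E *; rewrite -E bin2D in le_k *.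
  have -> : (n + n - (n + t) = n - t)%N by lia.
  have [s Es] : exists s, n = (t + s)%N by exists (n - t)%N; lia.
  rewrite Es addKn -Es.
  suff : (m * n * t = (x + r) * t)%N by rewrite Es; nia.
  by rewrite Ex.
set t := (n - k)%N in E *.
have -> : (n + n - k = n + t)%N by lia.
have [s Es] : exists s, m = (r + s)%N by exists (m - r)%N; lia.
rewrite Es addKn -Es -{2}E bin2D.
have := bin2_double t.
have : (m * n * t = (x + r) * t)%N by rewrite Ex.
rewrite -E Es; nia.
Qed.

(** The k-th term carries the power [jexp] of q, and its Gaussian binomial is known to the order in
    [qbin_limit]; together the error starts at q^n or later. In the proof [t] is |k - n|. *)
Lemma jexp_bound m r n k : (0 < r < m)%N -> (k <= n + n)%N ->
  (n <= jexp m r n k + m * (minn k (n + n - k)).+1)%N.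
Proof.
move=> /andP[r0 lt_rm] le_k.
pose t := if (n <= k)%N then (k - n)%N else (n - k)%N.
have Et : (minn k (n + n - k) = n - t)%N by rewrite /t; case: (leqP n k); lia.
have le_tn : (t <= n)%N by rewrite /t; case: (leqP n k); lia.
have le_E : (m * 'C(t, 2) + t <= jexp m r n k)%N.
  by rewrite /t /jexp; case: (leqP n k) => _; rewrite leq_add2l leq_pmull // subn_gt0.
have le_t : (t <= 'C(t, 2) + 1)%N.
  by elim: (t) => // a; rewrite binS bin1; lia.
rewrite Et; apply: leq_trans (_ : m * ('C(t, 2) + (n - t).+1) <= _)%N; last first.
  by rewrite mulnDr leq_add2r (leq_trans _ le_E) // leq_addr.
apply: leq_trans (_ : 'C(t, 2) + (n - t).+1 <= _)%N; first by lia.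
by rewrite leq_pmull //; apply: leq_trans lt_rm.
Qed.

Lemma qfac_dil m n : (0 < m)%N -> dil m (qfac q n) = qfac (q ^+ m) n.
Proof.
move=> m0; rewrite rmorph_prod; apply: eq_bigr => i _.
by rewrite rmorphB rmorph1 rmorphXn /= dilX.
Qed.

Lemma finite_triple_product m r n : (0 < n)%N -> (0 < r < m)%N ->
  \prod_(i < n) ((1 - q ^+ (m * i.+1 - r)) * (1 - q ^+ (m * i + r))) =
  \sum_(k < (n + n).+1)
    (-1) ^+ (k + n) * q ^+ jexp m r n k * qbin (q ^+ m) (n + n) k.
Proof.
move=> n0 /andP[r0 lt_rm].
(* The factors are q^(mn - r) - q^(m i) for i < 2n. The first n give -q^(m i) (1 - q^(m(n-i) - r));
   the last n, with i counted from 0 again, give q^(mn - r) (1 - q^(m i + r)). The total power of q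
   taken out is [b]. *)
pose b := (m * 'C(n, 2) + n * (m * n - r))%N.
apply: (@mulXn_inj b); rewrite mulr_sumr.
have := qbinomial (q ^+ m) (n + n) (q ^+ (m * n - r)) (-1).
rewrite big_split_ord /=.
rewrite (eq_bigr (fun i : 'I_n => (- 1) * ((q ^+ m) ^+ i * (1 - q ^+ (m * (n - i) - r)))));
  last first.
  move=> i _; rewrite mulrBr mulr1 -exprM -exprD.
  have -> : (m * i + (m * (n - i) - r) = m * n - r)%N by have := ltn_ord i; nia.
  by ring.
rewrite big_split /= prodr_const card_ord big_split /= prodrXr.
rewrite -(big_mkord xpredT id) bin2_sum.
rewrite [X in _ * (_ * X)](reindex_inj rev_ord_inj) /=.
rewrite (eq_bigr (fun i : 'I_n => 1 - q ^+ (m * i.+1 - r))); last first.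
  by move=> i _; rewrite subKn.
rewrite [X in _ * X = _ -> _](eq_bigr (fun i : 'I_n => q ^+ (m * n - r) * (1 - q ^+ (m * i + r)))); last first.
  move=> i _; rewrite mulrBr mulr1 -exprM -exprD mulN1r; congr (_ - q ^+ _).
  by nia.
rewrite big_split /= prodr_const card_ord => H.
have sgn1 : (-1) ^+ n * (-1) ^+ n = 1 :> pser by rewrite -exprD addnn -signr_odd odd_double.
rewrite big_split /=.
transitivity ((-1) ^+ n * ((-1) ^+ n * ((q ^+ m) ^+ 'C(n, 2) *
  \prod_(i < n) (1 - q ^+ (m * i.+1 - r))) * ((q ^+ (m * n - r)) ^+ n *
  \prod_(i < n) (1 - q ^+ (m * i + r))))).
  have -> : q ^+ b = (q ^+ m) ^+ 'C(n, 2) * (q ^+ (m * n - r)) ^+ n.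
    by rewrite -!exprM -exprD [((_ - _) * n)%N]mulnC.
  by rewrite 2!mulrA mulrA sgn1 mul1r; ring.
rewrite H mulr_sumr; apply: eq_bigr => k _.
have := @jexpE m r n k n0 (ltnW lt_rm) (ltn_ord k); rewrite -/b => Eb.
rewrite [in RHS]mulrA [q ^+ b * _]mulrCA -exprD -Eb !exprD -!exprM.
ring.
Qed.

Definition eulerP m := Pser (euler_f m).

Lemma qfac_euler m n : (0 < m)%N -> cong (q ^+ n.+1) (qfac (q ^+ m) n) (eulerP m).
Proof.
move=> m0; apply/congXnP => i lt_in; rewrite /= -(@euler_f_stable m i n) //.
suff -> : qfac (q ^+ m) n = Pser (fun j =>
    (\prod_(1 <= i < n.+1) (1 - 'X^(m * i)) : {poly int})`_j) by [].
elim: (n) => [|k IHk]; apply: pserP => j.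
  by rewrite /qfac big_ord0 big_geq //= coef1.
rewrite qfacS IHk; rewrite [RHS]/= [in RHS]big_nat_recr // coefM; apply: eq_bigr => s _; congr (_ * _).
by rewrite coefB coefXn coef1 pcoefD pcoefN -exprM pcoefXn.
Qed.

Lemma dil_euler m : (0 < m)%N -> dil m (eulerP 1) = eulerP m.
Proof.
move=> m0; apply: congXn_eq => n; apply: (@congXn_le n n.+1) => //.
apply: cong_trans (qfac_euler n m0); rewrite -qfac_dil //.
apply/cong_sym/(@congXn_le n.+1 (m * n.+1)); first by rewrite leq_pmull.
by apply: dil_cong => //; have := @qfac_euler 1 n isT; rewrite expr1.
Qed.

Lemma eulerP0 m : eulerP m 0%N = 1. Proof. exact: euler_f0. Qed.

Lemma qfac_le m l n : (0 < m)%N -> (l <= n)%N ->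
  cong (q ^+ (m * l.+1)) (qfac (q ^+ m) n) (eulerP m).
Proof.
move=> m0 le_ln; apply: (@congXn_le _ (m * n.+1)); first by rewrite leq_pmul2l.
rewrite -dil_euler // -qfac_dil //; apply: dil_cong => //.
by have := @qfac_euler 1 n isT; rewrite expr1.
Qed.

(** In [qbin_fac] for k + (2n - k) = 2n, all Pochhammer products agree with the Euler product to
    order m (l + 1), where l = min(k, 2n - k); one Euler product is then cancelled. *)
Lemma qbin_limit m n k : (0 < m)%N -> (k <= n + n)%N ->
  cong (q ^+ (m * (minn k (n + n - k)).+1))
    (qfac (q ^+ m) n * qbin (q ^+ m) (n + n) k) 1.
Proof.
move=> m0 le_k; set l := minn _ _.
have cF N : (l <= N)%N -> cong (q ^+ (m * l.+1)) (qfac (q ^+ m) N) (eulerP m).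
  exact: qfac_le.
rewrite (cF n); last by rewrite /l; lia.
apply: (@cong_unit_cancel _ (eulerP m)); first exact: eulerP0.
have := qbin_fac (q ^+ m) k (n + n - k); rewrite subnKC // => E.
have := cF (n + n)%N ltac:(rewrite /l; lia); rewrite -E.
rewrite (cF k) ?geq_minl // (cF (n + n - k)%N) ?geq_minr // mulr1 => H.
apply: cong_trans H; rewrite (_ : eulerP m * _ = qbin (q ^+ m) (n + n) k * eulerP m * eulerP m); last by ring.
exact: cong_refl.
Qed.

(** Partial sum of the theta series over j = k - n from -n to n; [k + n] has the parity of j. *)
Definition theta_sum m r n : pser :=
  \sum_(k < (n + n).+1) (-1) ^+ (k + n) * q ^+ jexp m r n k.

Lemma triple_product m r n : (0 < n)%N -> (0 < r < m)%N ->
  cong (q ^+ n)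
    (qfac (q ^+ m) n * \prod_(i < n) ((1 - q ^+ (m * i.+1 - r)) * (1 - q ^+ (m * i + r))))
    (theta_sum m r n).
Proof.
move=> n0 lt_rm; rewrite finite_triple_product // mulr_sumr.
apply: cong_sum => k; rewrite -[X in cong _ _ X]mulr1 mulrCA.
rewrite -!mulrA; apply: congM; first exact: cong_refl.
apply: (@congXn_le _ (jexp m r n k + m * (minn k (n + n - k)).+1)).
  by apply: jexp_bound => //; rewrite -ltnS.
apply: congXn_mul; apply: qbin_limit; last by rewrite -ltnS.
by case/andP: lt_rm => r0; apply: leq_trans.
Qed.

Lemma theta_sum_coef m r n N :
  theta_sum m r n N = \sum_(k < (n + n).+1) (-1) ^+ (k + n) * (jexp m r n k == N)%:R.
Proof.
rewrite pcoef_sum; apply: eq_bigr => k _.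
have -> : (-1) ^+ (k + n) * q ^+ jexp m r n k =
  if odd (k + n) then - q ^+ jexp m r n k else q ^+ jexp m r n k.
  by rewrite -signr_odd; case: odd; rewrite ?expr1 ?mulN1r ?mul1r.
rewrite -signr_odd; case: odd; rewrite ?pcoefN pcoefXn eq_sym;
by rewrite ?expr1 ?mulN1r ?mul1r.
Qed.

(** * The series of Euler and Gauss *)

Local Notation f1 := (eulerP 1).
Local Notation f2 := (eulerP 2).

(** The exponents 3i, 3i - 1 and 3i - 2 for i from 1 to n run through 1, ..., 3n. *)
Lemma qfac_mul3 n :
  qfac (q ^+ 3) n * \prod_(i < n) ((1 - q ^+ (3 * i.+1 - 1)) * (1 - q ^+ (3 * i + 1))) =
  qfac q (3 * n).
Proof.
elim: n => [|n IHn]; first by rewrite muln0 /qfac !big_ord0 mulr1.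
rewrite mulnS !addSn add0n !qfacS -IHn big_ord_recr /=.
have -> : (3 * n.+1 - 1 = (3 * n).+2)%N by lia.
rewrite addn1 -exprM (_ : (3 * n.+1 = (3 * n).+3)%N); last by lia.
by ring.
Qed.

Lemma pentagonal n N : (N < n)%N -> f1 N = theta_sum 3 1 n N.
Proof.
move=> lt_Nn; have n0 : (0 < n)%N by apply: leq_ltn_trans lt_Nn.
have := @triple_product 3 1 n n0 isT; rewrite qfac_mul3 => /congXnP/(_ N lt_Nn) <-.
have := @qfac_euler 1 (3 * n) isT; rewrite expr1 => /congXnP-> //.
by lia.
Qed.

(** With m = 2 and r = 1 both factors of the triple product run over the odd exponents, which gives
    a square; the additional [qfac (q ^+ 2) n] stands for the f_2 in f_2 phi = f_1^2. *)
Lemma qfac_mul2 n :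
  qfac (q ^+ 2) n * (qfac (q ^+ 2) n *
    \prod_(i < n) ((1 - q ^+ (2 * i.+1 - 1)) * (1 - q ^+ (2 * i + 1)))) =
  qfac q (2 * n) ^+ 2.
Proof.
elim: n => [|n IHn]; first by rewrite muln0 /qfac !big_ord0 !mulr1 expr1n.
rewrite mulnS !addSn add0n !qfacS big_ord_recr /=.
have -> : (2 * n.+1 - 1 = (2 * n).+1)%N by lia.
rewrite addn1 -exprM (_ : (2 * n.+1 = (2 * n).+2)%N); last by lia.
by ring: IHn.
Qed.

Definition phi := f1 ^+ 2 * pinv f2.

Lemma phiE : f2 * phi = f1 ^+ 2.
Proof. by rewrite mulrCA pmulV ?eulerP0 // mulr1. Qed.

Lemma gauss n N : (N < n)%N -> phi N = theta_sum 2 1 n N.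
Proof.
move=> lt_Nn; have n0 : (0 < n)%N by apply: leq_ltn_trans lt_Nn.
suff: cong (q ^+ n) phi (theta_sum 2 1 n) by move/congXnP->.
apply: (@cong_unit_cancel _ f2); rewrite ?eulerP0 // phiE.
have cF2 : cong (q ^+ n) (qfac (q ^+ 2) n) f2.
  by apply: (@congXn_le _ n.+1) => //; apply: qfac_euler.
rewrite -(@triple_product 2 1 n n0 isT) -{1}cF2 qfac_mul2.
apply: congX; apply/cong_sym/(@congXn_le _ (2 * n).+1); first by lia.
by have := @qfac_euler 1 (2 * n) isT; rewrite expr1.
Qed.

Lemma jexp31 n k : ((jexp 3 1 n k)%:Z * 2 = (k%:Z - n%:Z) * (3 * (k%:Z - n%:Z) - 1))%R.
Proof.
rewrite /jexp; case: (leqP n k) => [/subnKC|/ltnW/subnKC] E.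
  set t := (k - n)%N in E *; rewrite -E; have := bin2_double t; nia.
set t := (n - k)%N in E *; rewrite -E; have := bin2_double t; nia.
Qed.

Lemma jexp21 n k : ((jexp 2 1 n k)%:Z = (k%:Z - n%:Z) ^+ 2)%R.
Proof.
rewrite /jexp; case: (leqP n k) => [/subnKC|/ltnW/subnKC] E.
  set t := (k - n)%N in E *; rewrite -E; have := bin2_double t; nia.
set t := (n - k)%N in E *; rewrite -E; have := bin2_double t; nia.
Qed.

Lemma pent_inj (i j : int) : i * (3 * i - 1) = j * (3 * j - 1) -> i = j.
Proof.
move=> E; have : (i - j) * (3 * (i + j) - 1) = 0 by rewrite -[RHS](subrr (j * (3 * j - 1))) -{1}E; ring.
by move/eqP; rewrite mulf_eq0 => /orP[/eqP|/eqP]; lia.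
Qed.

Lemma pentagonal_coef (j : int) N : N%:Z * 2 = j * (3 * j - 1) -> f1 N = (-1) ^+ `|j|%N.
Proof.
(* [n] exceeds both N and |j|, so the truncated sum is exact at N and contains the index k = n + j;
   [pent_inj] excludes every other term. *)
move=> EN; pose n := (N + `|j| + 1)%N; pose k := absz (n%:Z + j).
have lt_k : (k < (n + n).+1)%N by rewrite /k /n; lia.
have Ek : k%:Z - n%:Z = j by rewrite /k /n; lia.
rewrite (@pentagonal n); last by rewrite /n; lia.
rewrite theta_sum_coef (bigD1 (Ordinal lt_k)) //= big1 => [|i ne_i].
  have -> : jexp 3 1 n k == N by have := jexp31 n k; rewrite Ek -EN; lia.
  rewrite mulr1 addr0 -signr_odd -[in RHS]signr_odd; congr (_ ^+ nat_of_bool _).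
  by rewrite -Ek; lia.
case: eqP => [Ei|_]; last by rewrite mulr0.
case/eqP: ne_i; apply: val_inj => /=.
have := jexp31 n i; rewrite Ei EN -Ek => /pent_inj; lia.
Qed.

Lemma pentagonal_coef0 N : ~ (exists j : int, N%:Z * 2 = j * (3 * j - 1)) -> f1 N = 0.
Proof.
move=> nN; rewrite (@pentagonal N.+1) // theta_sum_coef big1 // => i _.
case: eqP => [Ei|_]; last by rewrite mulr0.
by case: nN; exists (i%:Z - N.+1%:Z); rewrite -jexp31 Ei.
Qed.

Lemma int_mod5 (j : int) :
  exists t : int, exists2 s : int, j = 5 * t + s & [|| s == 0, s == 1, s == 2, s == 3 | s == 4].
Proof. by exists (j %/ 5)%Z, (j %% 5)%Z; lia. Qed.

(** If j (3j - 1)/2 is 1 modulo 5 then j = 5t + 1, and (j (3j - 1)/2 - 1)/25 = t (3t + 1)/2 is the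
    pentagonal number of index -t; the sign changes because 5t + 1 and t have opposite parity. *)
Lemma euler_sec1 : sec 1 f1 = - dil 5 f1.
Proof.
apply: pserP => N; rewrite pcoefN [LHS]/= [X in _ = - X]/=.
rewrite -[euler_f 1]/(pcoef f1).
have [[j Ej]|nj] := pselect (exists j : int, (5 * N + 1)%N%:Z * 2 = j * (3 * j - 1)).
  have [t [s Es Hs]] := int_mod5 j.
  have {Hs} Es1 : s = 1.
    case/or4P: Hs => [||| /orP[]] /eqP E; rewrite Es E in Ej *; lia.
  have EN : N%:Z = 5 * (N %/ 5)%N%:Z by rewrite Es Es1 in Ej; lia.
  have EM : (N %/ 5)%N%:Z * 2 = - t * (3 * - t - 1) by rewrite Es Es1 in Ej; lia.
  rewrite (pentagonal_coef Ej) ifT; last by lia.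
  rewrite (pentagonal_coef EM) -signr_odd -[in RHS]signr_odd.
  have -> : odd `|j| = ~~ odd `|- t| by rewrite Es Es1; lia.
  by case: odd; rewrite ?expr1 ?expr0 ?opprK.
rewrite (pentagonal_coef0 nj); case: ifP => [/dvdnP[M EN]|_]; last by rewrite oppr0.
rewrite EN mulnK // pentagonal_coef0 ?oppr0 // => -[t Et].
by case: nj; exists (1 - 5 * t); rewrite EN; lia.
Qed.

(** Generalised pentagonal numbers are 0, 1 or 2 modulo 5. *)
Lemma euler_sec3 : sec 3 f1 = 0.
Proof.
apply: pserP => N; rewrite [LHS]/= -[euler_f 1]/(pcoef f1) pentagonal_coef0 // => -[j Ej].
have [t [s Es Hs]] := int_mod5 j.
by case/or4P: Hs => [||| /orP[]] /eqP E; rewrite Es E in Ej *; lia.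
Qed.

Lemma euler_sec4 : sec 4 f1 = 0.
Proof.
apply: pserP => N; rewrite [LHS]/= -[euler_f 1]/(pcoef f1) pentagonal_coef0 // => -[j Ej].
have [t [s Es Hs]] := int_mod5 j.
by case/or4P: Hs => [||| /orP[]] /eqP E; rewrite Es E in Ej *; lia.
Qed.

Lemma phi_coef0 N : ~ (exists j : int, N%:Z = j ^+ 2) -> phi N = 0.
Proof.
move=> nN; rewrite (@gauss N.+1) // theta_sum_coef big1 // => i _.
case: eqP => [Ei|_]; last by rewrite mulr0.
by case: nN; exists (i%:Z - N.+1%:Z); rewrite -jexp21 Ei.
Qed.

Lemma phi_coef_sq t : (0 < t)%N -> phi (t ^ 2)%N = 2 * (-1) ^+ t.
Proof.
move=> t0; pose n := (t ^ 2).+1; have lt_tn : (t < n)%N by rewrite /n; nia.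
have lt1 : (n + t < (n + n).+1)%N by lia.
have lt2 : (n - t < (n + n).+1)%N by lia.
rewrite (@gauss n) // theta_sum_coef (bigD1 (Ordinal lt1)) //=.
rewrite (bigD1 (Ordinal lt2)) /=; last by rewrite -val_eqE /=; lia.
have -> : jexp 2 1 n (n + t) == (t ^ 2)%N by have := jexp21 n (n + t); lia.
have -> : jexp 2 1 n (n - t) == (t ^ 2)%N by have := jexp21 n (n - t); lia.
rewrite big1 => [|i /andP[]].
  have E k : odd (k + n) = odd t -> (-1) ^+ (k + n) = (-1) ^+ t :> int.
    by rewrite -signr_odd => ->; rewrite signr_odd.
  by rewrite !E /=; [ring | lia..].
rewrite -!val_eqE /= => ne1 ne2; case: eqP => [Ei|_]; last by rewrite mulr0.
by have := jexp21 n i; rewrite Ei; nia.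
Qed.

(** A square divisible by 5 is (5t)^2, and the sign (-1)^(5t) equals (-1)^t. *)
Lemma phi_sec0 : sec 0 phi = dil 5 phi.
Proof.
apply: pserP => N; transitivity (phi (5 * N)%N); first by rewrite /= addn0.
transitivity (if (5 %| N)%N then phi (N %/ 5)%N else 0); last by [].
have [[j Ej]|nj] := pselect (exists j : int, (5 * N)%N%:Z = j ^+ 2).
  have [t [s Es Hs]] := int_mod5 j.
  have {Hs} Es0 : s = 0.
    by case/or4P: Hs => [||| /orP[]] /eqP E; rewrite Es E in Ej *; lia.
  have EN : N = (5 * `|t| ^ 2)%N by rewrite Es Es0 in Ej; lia.
  rewrite EN dvdn_mulr // mulKn //.
  have -> : (5 * (5 * `|t| ^ 2) = (5 * `|t|) ^ 2)%N by lia.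
  have [->|t0] := posnP `|t|%N; first by [].
  rewrite !phi_coef_sq ?muln_gt0 // -signr_odd -[in RHS]signr_odd.
  by congr (_ * _ ^+ nat_of_bool _); lia.
rewrite (phi_coef0 nj); case: ifP => [/dvdnP[M EN]|_] //.
rewrite EN mulnK // phi_coef0 // => -[t Et].
by case: nj; exists (5 * t); rewrite EN; lia.
Qed.

(** Squares are 0, 1 or 4 modulo 5. *)
Lemma phi_sec2 : sec 2 phi = 0.
Proof.
apply: pserP => N; transitivity (phi (5 * N + 2)%N); first by [].
rewrite phi_coef0 // => -[j Ej]; have [t [s Es Hs]] := int_mod5 j.
by case/or4P: Hs => [||| /orP[]] /eqP E; rewrite Es E in Ej *; lia.
Qed.

Lemma phi_sec3 : sec 3 phi = 0.
Proof.
apply: pserP => N; transitivity (phi (5 * N + 3)%N); first by [].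
rewrite phi_coef0 // => -[j Ej]; have [t [s Es Hs]] := int_mod5 j.
by case/or4P: Hs => [||| /orP[]] /eqP E; rewrite Es E in Ej *; lia.
Qed.

(** * Five-dissections of [f_1] and [f_2] *)

(** The shape of f_1/f_25 and, for [dis2], of f_2/f_50, where x is A or B and y its inverse. The
    inverse is a separate argument so that everything stays polynomial and [ring] needs only x y =
    1. *)
Definition dis1 (x y : pser) := dil 5 x - q - q ^+ 2 * dil 5 y.
Definition dis2 (x y : pser) := dil 5 x - q ^+ 2 - q ^+ 4 * dil 5 y.

Lemma dil5q : dil 5 q = q ^+ 5. Proof. exact: dilX. Qed.

Lemma dil5K (x y : pser) : x * y = 1 -> dil 5 x * dil 5 y = 1.
Proof. by move=> xy; rewrite -rmorphM xy rmorph1. Qed.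

(** Here and below the arguments of [sec5E] come from expanding the product with A Ai = B Bi = 1 and
    collecting powers of q by residue modulo 5. *)
Lemma sec3_dis12 (A Ai B Bi : pser) : A * Ai = 1 -> B * Bi = 1 ->
  sec 3 (dis1 A Ai * dis2 B Bi) = 1.
Proof.
move=> AK BK; rewrite (@sec5E _
  (A * B + q * Bi) (- B + q * Ai * Bi) (- A - Ai * B) (1) (- A * Bi + Ai)) //.
rewrite /dis1 /dis2 !(rmorph_nat, rmorphXn, rmorphM, rmorphN, rmorphD, rmorph1, rmorph0) /= ?dil5q.
by ring: (dil5K AK) (dil5K BK).
Qed.

Lemma sec1_dis2_exp3 (B Bi : pser) : B * Bi = 1 ->
  sec 1 (dis2 B Bi ^+ 3) = 5 * q.
Proof.
move=> BK; rewrite (@sec5E _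
  (B ^+ 3 - 3 * q ^+ 2 * Bi ^+ 2) (5 * q) (- 3 * B ^+ 2 - q ^+ 2 * Bi ^+ 3) (0) (0)) //.
rewrite /dis1 /dis2 !(rmorph_nat, rmorphXn, rmorphM, rmorphN, rmorphD, rmorph1, rmorph0) /= ?dil5q.
by ring: (dil5K BK).
Qed.

Lemma sec3_dis2_exp4 (B Bi : pser) : B * Bi = 1 ->
  sec 3 (dis2 B Bi ^+ 4) = - 5 * q.
Proof.
move=> BK; rewrite (@sec5E _
  (B ^+ 4 - 8 * q ^+ 2 * Bi) (8 * q * B + q ^+ 3 * Bi ^+ 4) (- 4 * B ^+ 3 + 2 * q ^+ 2 * Bi
  ^+ 2) (- 5 * q) (2 * B ^+ 2 + 4 * q ^+ 2 * Bi ^+ 3)) //.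
rewrite /dis1 /dis2 !(rmorph_nat, rmorphXn, rmorphM, rmorphN, rmorphD, rmorph1, rmorph0) /= ?dil5q.
by ring: (dil5K BK).
Qed.

Lemma sec1_dis2_exp8 (B Bi : pser) : B * Bi = 1 ->
  sec 1 (dis2 B Bi ^+ 8) = - 125 * q ^+ 3.
Proof.
move=> BK; rewrite (@sec5E _
  (B ^+ 8 + 56 * q ^+ 2 * B ^+ 3 + 112 * q ^+ 4 * Bi ^+ 2 + 8 * q ^+ 6 * Bi ^+ 7) (- 125 *
  q ^+ 3) (- 8 * B ^+ 7 + 112 * q ^+ 2 * B ^+ 2 - 56 * q ^+ 4 * Bi ^+ 3 + q ^+ 6 * Bi ^+ 8)
  (- 70 * q * B ^+ 4 + 120 * q ^+ 3 * Bi + 20 * q ^+ 5 * Bi ^+ 6) (20 * B ^+ 6 - 120 * q ^+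
  2 * B - 70 * q ^+ 4 * Bi ^+ 4)) //.
rewrite /dis1 /dis2 !(rmorph_nat, rmorphXn, rmorphM, rmorphN, rmorphD, rmorph1, rmorph0) /= ?dil5q.
by ring: (dil5K BK).
Qed.

Lemma sec2_dis1_exp2 (A Ai : pser) : A * Ai = 1 ->
  sec 2 (dis1 A Ai ^+ 2) = - 1.
Proof.
move=> AK; rewrite (@sec5E _
  (A ^+ 2) (- 2 * A) (- 1) (2 * Ai) (Ai ^+ 2)) //.
rewrite /dis1 /dis2 !(rmorph_nat, rmorphXn, rmorphM, rmorphN, rmorphD, rmorph1, rmorph0) /= ?dil5q.
by ring: (dil5K AK).
Qed.

(** It enters in two ways: through section 2 of f_1^3 f_2^2 in [sec2_dis12_exp32], and squared in
    [sec4_rest2]. *)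
Definition lser (A Ai B Bi : pser) :=
  B * (A ^+ 3 - 3 * q * Ai ^+ 2) + q * Bi * (3 * A ^+ 2 + q * Ai ^+ 3).

Lemma sec2_dis12_exp32 (A Ai B Bi : pser) : A * Ai = 1 -> B * Bi = 1 ->
  sec 2 (dis1 A Ai ^+ 3 * dis2 B Bi ^+ 2) = - 2 * lser A Ai B Bi - 5 * q.
Proof.
move=> AK BK; rewrite (@sec5E _
  (A ^+ 3 * B ^+ 2 + 3 * q * A ^+ 2 - 10 * q * B - 3 * q * Ai ^+ 2 * B ^+ 2 + q ^+ 2 * Ai
  ^+ 3) (2 * q * A ^+ 3 * Bi - 3 * A ^+ 2 * B ^+ 2 + 5 * q ^+ 2 * Bi ^+ 2 - 6 * q ^+ 2 * Ai
  ^+ 2 * Bi - q * Ai ^+ 3 * B ^+ 2) (- 2 * A ^+ 3 * B - 6 * q * A ^+ 2 * Bi - 5 * q + 6 * q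
  * Ai ^+ 2 * B - 2 * q ^+ 2 * Ai ^+ 3 * Bi) (q * A ^+ 3 * Bi ^+ 2 + 6 * A ^+ 2 * B + 5 * B
  ^+ 2 - 3 * q ^+ 2 * Ai ^+ 2 * Bi ^+ 2 + 2 * q * Ai ^+ 3 * B) (- A ^+ 3 - 3 * q * A ^+ 2 *
  Bi ^+ 2 + 10 * q * Bi + 3 * q * Ai ^+ 2 - q ^+ 2 * Ai ^+ 3 * Bi ^+ 2)) //.
  by rewrite /lser /=; ring.
rewrite /dis1 /dis2 !(rmorph_nat, rmorphXn, rmorphM, rmorphN, rmorphD, rmorph1, rmorph0) /= ?dil5q.
by ring: (dil5K AK) (dil5K BK).
Qed.

Lemma sec_dis1_exp4 (A Ai : pser) r : A * Ai = 1 -> (r < 5)%N ->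
  sec r (dis1 A Ai ^+ 4) = nth 0
   [:: A ^+ 4 - 8 * q * Ai; - 4 * A ^+ 3 + 2 * q * Ai ^+ 2; 2 * A ^+ 2 + 4 * q * Ai ^+ 3; 8 * A + q * Ai ^+ 4; - 5] r.
Proof.
move=> AK; apply: sec5E; rewrite /dis1 !(rmorph_nat, rmorphXn, rmorphM, rmorphN, rmorphD, rmorph1, rmorph0) /= ?dil5q.
by ring: (dil5K AK).
Qed.

(** Two residues add up to at most 8, so only pairs with sum exactly 4 contribute and no factor q
    appears. *)
Lemma sec4M x y : sec 4 (x * y) =
  sec 0 x * sec 4 y + sec 1 x * sec 3 y + sec 2 x * sec 2 y + sec 3 x * sec 1 y +
  sec 4 x * sec 0 y.
Proof.
rewrite {1}[x]dissection {1}[y]dissection !big_ord_recl !big_ord0 /=.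
set x0 := sec 0 x; set x1 := sec 1 x; set x2 := sec 2 x; set x3 := sec 3 x; set x4 := sec 4 x.
set y0 := sec 0 y; set y1 := sec 1 y; set y2 := sec 2 y; set y3 := sec 3 y; set y4 := sec 4 y.
rewrite (@sec5E _ (x0 * y0 + q * (x1 * y4 + x2 * y3 + x3 * y2 + x4 * y1))
  (x0 * y1 + x1 * y0 + q * (x2 * y4 + x3 * y3 + x4 * y2))
  (x0 * y2 + x1 * y1 + x2 * y0 + q * (x3 * y4 + x4 * y3))
  (x0 * y3 + x1 * y2 + x2 * y1 + x3 * y0 + q * (x4 * y4))
  (x0 * y4 + x1 * y3 + x2 * y2 + x3 * y1 + x4 * y0)) //.
by rewrite !(rmorphD, rmorphM) /= dil5q; ring.
Qed.

(** * Fifth powers of the dissections *)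

(** Modulo 5, the fifth power of [dis1 A Ai] is this series at q^5. The exact norm over the fifth
    roots of unity has 11 q in place of q. *)
Definition norm1 (A Ai : pser) := A ^+ 5 - q - q ^+ 2 * Ai ^+ 5.
Definition norm2 (B Bi : pser) := B ^+ 5 - q ^+ 2 - q ^+ 4 * Bi ^+ 5.

(** The quotient by 5 of [dis1 A Ai ^+ 5] minus V of [norm1 A Ai], written by its five sections so
    that [sec5E] applies with [erefl]. *)
Definition rest1 (A Ai : pser) :=
  dil 5 (- 2 * q) + q * dil 5 (- A ^+ 4 + 3 * q * Ai) + q ^+ 2 * dil 5 (A ^+ 3 + 2 * q * Ai
  ^+ 2) + q ^+ 3 * dil 5 (2 * A ^+ 2 - q * Ai ^+ 3) + q ^+ 4 * dil 5 (- 3 * A - q * Ai ^+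
  4).
Definition rest2 (B Bi : pser) :=
  dil 5 (- 2 * q ^+ 2) + q * dil 5 (2 * q * B ^+ 2 - q ^+ 3 * Bi ^+ 3) + q ^+ 2 * dil 5 (-
  B ^+ 4 + 3 * q ^+ 2 * Bi) + q ^+ 3 * dil 5 (- 3 * q * B - q ^+ 3 * Bi ^+ 4) + q ^+ 4 *
  dil 5 (B ^+ 3 + 2 * q ^+ 2 * Bi ^+ 2).

Lemma dis1_exp5 (A Ai : pser) : A * Ai = 1 ->
  dis1 A Ai ^+ 5 = dil 5 (norm1 A Ai) + 5 * rest1 A Ai.
Proof.
move=> AK; rewrite /dis1 /norm1 /rest1 !(rmorph_nat, rmorphXn, rmorphM, rmorphN, rmorphD, rmorph1, rmorph0) /= ?dil5q.
by ring: (dil5K AK).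
Qed.

Lemma dis2_exp5 (B Bi : pser) : B * Bi = 1 ->
  dis2 B Bi ^+ 5 = dil 5 (norm2 B Bi) + 5 * rest2 B Bi.
Proof.
move=> BK; rewrite /dis2 /norm2 /rest2 !(rmorph_nat, rmorphXn, rmorphM, rmorphN, rmorphD, rmorph1, rmorph0) /= ?dil5q.
by ring: (dil5K BK).
Qed.

Lemma sec4_rest1 (A Ai : pser) : A * Ai = 1 ->
  cong 5 (sec 4 (rest1 A Ai * dis1 A Ai ^+ 4)) (- 2 * norm1 A Ai).
Proof.
move=> AK; rewrite sec4M !(sec_dis1_exp4 AK) // !(sec5E (erefl (rest1 A Ai))) //=.
exists (- 3 * A ^+ 5 + 14 * q + 3 * q ^+ 2 * Ai ^+ 5).
by rewrite /norm1; ring: AK.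
Qed.

(* The witness and the cofactor come from long division of the difference of the
   two sides, as a polynomial in [A], by the relation [AB] modulo 5. *)
Lemma sec4_rest2 (A Ai B Bi : pser) : A * Ai = 1 -> B * Bi = 1 ->
  A * B ^+ 2 * (A ^+ 2 - B) = q * (A ^+ 2 + B) ->
  cong 5 (sec 4 (rest2 B Bi * dis1 A Ai ^+ 4)) (- 2 * norm2 B Bi + lser A Ai B Bi ^+ 2).
Proof.
move=> AK BK AB; rewrite sec4M !(sec_dis1_exp4 AK) // !(sec5E (erefl (rest2 B Bi))) //=.
exists (
  - q * A ^+ 5 - 2 * q ^+ 2 * A ^+ 4 * Bi ^+ 2 + 2 * q * A ^+ 3 * B + q ^+ 3 * A ^+ 3 * Bi
  ^+ 4 + q ^+ 2 * A ^+ 2 * Bi + 4 * q * A * B ^+ 2 - 2 * q ^+ 3 * A * Bi ^+ 3 + 4 * q ^+ 2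
  - 2 * q * Ai * B ^+ 3 - 4 * q ^+ 3 * Ai * Bi ^+ 2 - q ^+ 2 * Ai ^+ 2 * B - q * Ai ^+ 3 *
  B ^+ 4 + 2 * q ^+ 3 * Ai ^+ 3 * Bi - 2 * q ^+ 2 * Ai ^+ 4 * B ^+ 2 + q ^+ 3 * Ai ^+ 5).
apply/eqP; rewrite -subr_eq0; apply/eqP.
transitivity ((A * B ^+ 2 * (A ^+ 2 - B) - q * (A ^+ 2 + B)) * (
  - A ^+ 3 - 2 * q * A ^+ 2 * Bi ^+ 2 + q ^+ 2 * A * Bi ^+ 4 - q * Bi - 2 * Ai * B ^+ 2 - q
  ^+ 2 * Ai * Bi ^+ 3 - q * Ai ^+ 2 + 2 * q ^+ 3 * Ai ^+ 2 * Bi ^+ 5 + q ^+ 2 * Ai ^+ 3 *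
  Bi ^+ 2 - q * Ai ^+ 4 * B - 2 * q ^+ 2 * Ai ^+ 5 * Bi + q ^+ 3 * Ai ^+ 6 * Bi ^+ 3)); last by rewrite AB subrr mul0r.
by rewrite /norm2 /lser; ring: AK BK.
Qed.

(** The difference of the sides is 5 times the witness plus a multiple of the relation between A and
    B; the second list is the cofactor of that relation. With [norm1_f1] and [norm2_f2] this
    identifies L^3 modulo 5. *)
Lemma lser_exp3 (A Ai B Bi : pser) : A * Ai = 1 -> B * Bi = 1 ->
  A * B ^+ 2 * (A ^+ 2 - B) = q * (A ^+ 2 + B) ->
  cong 5 (lser A Ai B Bi ^+ 3) (norm1 A Ai * norm2 B Bi).
Proof.
move=> AK BK AB.
exists (
  2 * q * A ^+ 8 * B + 5 * q ^+ 2 * A ^+ 7 * Bi + 6 * q ^+ 3 * A ^+ 6 * Bi ^+ 3 + q ^+ 2 *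
  A ^+ 5 - q * A ^+ 4 * B ^+ 3 - 10 * q ^+ 2 * A ^+ 3 * B - 12 * q ^+ 3 * A ^+ 2 * Bi + 5 *
  q ^+ 4 * A * Bi ^+ 3 - q ^+ 3 + 5 * q ^+ 2 * Ai * B ^+ 3 + 12 * q ^+ 3 * Ai ^+ 2 * B - 10
  * q ^+ 4 * Ai ^+ 3 * Bi + q ^+ 5 * Ai ^+ 4 * Bi ^+ 3 - q ^+ 4 * Ai ^+ 5 - 6 * q ^+ 3 * Ai
  ^+ 6 * B ^+ 3 + 5 * q ^+ 4 * Ai ^+ 7 * B - 2 * q ^+ 5 * Ai ^+ 8 * Bi).
apply/eqP; rewrite -subr_eq0; apply/eqP.
transitivity ((A * B ^+ 2 * (A ^+ 2 - B) - q * (A ^+ 2 + B)) * (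
  A ^+ 6 * B + A ^+ 4 * B ^+ 2 + 2 * q ^+ 2 * A ^+ 4 * Bi ^+ 3 + 2 * q * A ^+ 3 - q ^+ 3 *
  A ^+ 3 * Bi ^+ 5 - q * A * B + q ^+ 3 * A * Bi ^+ 4 - q * Ai * B ^+ 2 - 2 * q ^+ 3 * Ai *
  Bi ^+ 3 - 2 * q ^+ 2 * Ai ^+ 2 + q ^+ 4 * Ai ^+ 2 * Bi ^+ 5 - q ^+ 2 * Ai ^+ 4 * B - q ^+
  4 * Ai ^+ 4 * Bi ^+ 4 - q ^+ 2 * Ai ^+ 6 * B ^+ 2 - 2 * q ^+ 4 * Ai ^+ 6 * Bi ^+ 3 - 2 *
  q ^+ 3 * Ai ^+ 7 + q ^+ 5 * Ai ^+ 7 * Bi ^+ 5 - q ^+ 5 * Ai ^+ 9 * Bi ^+ 4)); last by rewrite AB subrr mul0r.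
by rewrite /norm1 /norm2 /lser; ring: AK BK.
Qed.

(** * The series A and B and the relations between them *)

Local Notation f5 := (eulerP 5).
Local Notation f10 := (eulerP 10).

Lemma mulrn_inj k (x y : pser) : (0 < k)%N -> k%:R * x = k%:R * y -> x = y.
Proof.
move=> k0 E; apply: pserP => n; have := congr1 (fun z : pser => z n) E.
rewrite !mulr_natl !pcoefMn => /eqP.
by rewrite -[_ *+ k]mulr_natl -[y n *+ k]mulr_natl => /eqP/mulfI; apply; lia.
Qed.

Lemma unit_mulI (u x y : pser) : u 0%N = 1 -> u * x = u * y -> x = y.
Proof.
move=> u0 E; rewrite -[x]mul1r -[y]mul1r -(pmulV u0).
by rewrite [u * _]mulrC -!mulrA E.
Qed.

(* Up to the factor q^(1/5), [rA] is the reciprocal of the Rogers-Ramanujan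
   continued fraction and [rAi] its inverse; see [rAK]. *)
Definition rA := pinv f5 * sec 0 f1.
Definition rAi := - (pinv f5 * sec 2 f1).
Definition rB := dil 2 rA.
Definition rBi := dil 2 rAi.

Local Notation A := rA.
Local Notation Ai := rAi.
Local Notation B := rB.
Local Notation Bi := rBi.

Lemma dil5_f1 : dil 5 f1 = f5. Proof. exact: dil_euler. Qed.
Lemma dil5_f2 : dil 5 f2 = f10.
Proof. by rewrite -(@dil_euler 2) // dil_dil // dil_euler. Qed.
Lemma dil2_f5 : dil 2 f5 = f10.
Proof. by rewrite -dil5_f1 dil_dil // dil_euler. Qed.

Lemma f1_dissect : f1 = dil 5 f5 * dis1 A Ai.
Proof.
rewrite {1}[f1]dissection !big_ord_recl big_ord0 /= euler_sec1 euler_sec3 euler_sec4.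
rewrite dil5_f1 /dis1 /A /Ai rmorphN rmorph0 rmorphN !rmorphM /=.
have E : dil 5 f5 * dil 5 (pinv f5) = 1 by rewrite -rmorphM /= pmulV ?eulerP0 // rmorph1.
by ring: E.
Qed.

Lemma f2_dissect : f2 = dil 5 f10 * dis2 B Bi.
Proof.
rewrite -(@dil_euler 2) // f1_dissect rmorphM /= dilC // dil2_f5; congr (_ * _).
rewrite /dis1 /dis2 2!rmorphB (rmorphM _ (q ^+ 2)) rmorphXn /= dilX // -exprM.
by rewrite (@dilC 2 5) // (@dilC 2 5 Ai).
Qed.

Lemma rA0 : A 0%N = 1.
Proof. by rewrite pcoefM0 pinv0 mul1r; apply: (eulerP0 1). Qed.

Lemma rB0 : B 0%N = 1.
Proof. exact: rA0. Qed.

Lemma phi_dissect :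
  phi = dil 5 (sec 0 phi) + q * dil 5 (sec 1 phi) + q ^+ 4 * dil 5 (sec 4 phi).
Proof.
rewrite {1}[phi]dissection !big_ord_recl big_ord0 /= phi_sec2 phi_sec3 !rmorph0.
by ring.
Qed.

Section PhiEquations.

Let a := f5 * A.
Let b := f5 * Ai.
Let e := f10 * B.
Let h := f10 * Bi.
Let x := sec 0 phi.
Let y := sec 1 phi.
Let z := sec 4 phi.

(** The two lists are the sections of f_2 phi and of f_1^2; x, y, z are sections 0, 1, 4 of phi, the
    others being 0. *)
Let phi_sections r : (r < 5)%N ->
  nth 0 [:: e * x - q * h * y; e * y - q * f10 * z; - (f10 * x); - (f10 * y) - q * h * z;
            e * z - h * x] r =
  nth 0 [:: a ^+ 2; - 2 * a * f5; f5 ^+ 2 - 2 * a * b; 2 * b * f5; b ^+ 2] r.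
Proof.
move=> lt_r5; rewrite -(@sec5E (f2 * phi)) //; last first.
  rewrite f2_dissect phi_dissect -/x -/y -/z /dis2 /e /h.
  rewrite !rmorphB !rmorphM !rmorphN !rmorphM /= dil5q.
  by ring.
rewrite phiE (@sec5E _ (a ^+ 2) (- 2 * a * f5) (f5 ^+ 2 - 2 * a * b) (2 * b * f5) (b ^+ 2)) //.
rewrite f1_dissect /dis1 /a /b !(rmorphB, rmorphN, rmorphM, rmorph_nat) /=.
by ring.
Qed.

Let gx : f10 * x = f5 ^+ 2.
Proof. by rewrite /x phi_sec0 -dil5_f2 -rmorphM phiE rmorphXn /= dil5_f1. Qed.

Lemma rAK : A * Ai = 1.
Proof.
have := @phi_sections 2 isT; rewrite /= gx /a /b => E.
apply: (@unit_mulI (f5 ^+ 2)); first exact/pcoefX0/eulerP0.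
apply: (@mulrn_inj 2) => //; rewrite mulr1.
have -> : 2 * (f5 ^+ 2 * (A * Ai)) = f5 ^+ 2 - (f5 ^+ 2 - 2 * (f5 * A) * (f5 * Ai)) by ring.
by rewrite -E; ring.
Qed.

Lemma rBK : B * Bi = 1.
Proof. by rewrite -rmorphM rAK rmorph1. Qed.

(** Eliminating y from sections 1 and 3 gives z; section 4, with f_10 x = f_5^2, gives z a second
    time. The relation equates the two. *)
Lemma rAB : A * B ^+ 2 * (A ^+ 2 - B) = q * (A ^+ 2 + B).
Proof.
have E1 := @phi_sections 1 isT; have E3 := @phi_sections 3 isT.
have E4 := @phi_sections 4 isT; rewrite /= in E1 E3 E4.
have H1 : 2 * (q * (f10 * z)) = 2 * (f5 ^+ 2 * (A - Ai * B)).
  have -> : 2 * (q * (f10 * z)) =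
      - ((e * y - q * f10 * z) + B * (- (f10 * y) - q * h * z)).
    by rewrite /e /h; ring: rBK.
  by rewrite E1 E3 /a /b; ring.
have H4 : f10 * B * z = f5 ^+ 2 * (Ai ^+ 2 + Bi).
  have -> : f10 * B * z = (e * z - h * x) + Bi * (f10 * x) by rewrite /e /h; ring.
  by rewrite E4 gx /b; ring.
apply: (@unit_mulI (f5 ^+ 2)); first exact/pcoefX0/eulerP0.
apply: (@mulrn_inj 2) => //.
transitivity (A ^+ 2 * B ^+ 2 * (2 * (f5 ^+ 2 * (A - Ai * B)))); first by ring: rAK.
transitivity (2 * q * A ^+ 2 * B * (f5 ^+ 2 * (Ai ^+ 2 + Bi))); last by ring: rAK rBK.
by rewrite -H1 -H4; ring.
Qed.

End PhiEquations.

(** * Congruences modulo 5 and 25 *)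

Lemma pcoef_natM k (x : pser) n : (k%:R * x) n = k%:R * x n.
Proof. by rewrite !mulr_natl pcoefMn. Qed.

Lemma cong_natP k (x y : pser) : (0 < k)%N ->
  (forall n, (k%:Z %| x n - y n)%Z) <-> cong k%:R x y.
Proof.
move=> k0; split=> [dvd_xy|[z ->] n]; last first.
  by rewrite pcoefD pcoef_natM addrAC subrr add0r natz dvdz_mulr.
exists (Pser (fun n => (x n - y n) %/ k%:Z)%Z); apply: pserP => n.
rewrite pcoefD pcoef_natM /= natz mulrC divzK; last exact: dvd_xy.
by rewrite addrC subrK.
Qed.

Lemma sec_natM k r (x : pser) : sec r (k%:R * x) = k%:R * sec r x.
Proof. by rewrite !mulr_natl raddfMn. Qed.

Lemma sec_cong k r x y : cong k%:R x y -> cong k%:R (sec r x) (sec r y).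
Proof. by case=> z ->; exists (sec r z); rewrite raddfD /= sec_natM. Qed.

Lemma cong_mul5 x y : cong 5 x y -> cong 25 (5 * x) (5 * y).
Proof. by case=> z ->; exists z; ring. Qed.

Lemma fermat5 (x : int) : (5 %| x ^+ 5 - x)%Z.
Proof.
have [t [s -> Hs]] := int_mod5 x.
have -> : (5 * t + s) ^+ 5 - (5 * t + s) = 5 * (625 * t ^+ 5 + 625 * t ^+ 4 * s +
  250 * t ^+ 3 * s ^+ 2 + 50 * t ^+ 2 * s ^+ 3 + 5 * t * s ^+ 4 - t) + (s ^+ 5 - s) by ring.
rewrite rpredD ?dvdz_mulr //.
by case/or4P: Hs => [||| /orP[]] /eqP ->.
Qed.

(** Induction on the coefficient index: with x = x_0 + q y and x_0^5 = x_0 modulo 5, the difference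
    x^5 - V x is q^5 (y^5 - V y) modulo 5. *)
Lemma frobenius x : cong 5 (x ^+ 5) (dil 5 x).
Proof.
apply/cong_natP => // n; elim/ltn_ind: n x => n IHn x.
pose x0 : int := x 0%N; pose y := Pser (fun i => x i.+1).
have Ex : x = x0%:~R + q * y.
  apply: pserP => i; rewrite pcoefD -[q]expr1 pcoefXM.
  have -> : (x0%:~R : pser) i = if i == 0%N then x0 else 0.
    have E m : (m%:R : pser) i = if i == 0%N then m%:Z else 0.
      by rewrite pcoefMn; case: i => [|i]; [apply: natz | apply: mul0rn].
    by case: (x0) => m; rewrite ?NegzE ?mulrNz ?pcoefN E; case: eqP; rewrite ?oppr0.
  by case: i => [|i]; rewrite /= ?addr0 ?add0r // subn1.
have [t Et] : exists t, x0 ^+ 5 = x0 + 5 * t.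
  by have /dvdzP[t Et] := fermat5 x0; exists t; rewrite [5 * t]mulrC -Et addrC subrK.
pose z : pser := t%:~R + x0%:~R ^+ 4 * (q * y) + 2 * x0%:~R ^+ 3 * (q * y) ^+ 2 +
  2 * x0%:~R ^+ 2 * (q * y) ^+ 3 + x0%:~R * (q * y) ^+ 4.
rewrite -pcoefN -pcoefD.
have -> : x ^+ 5 - dil 5 x = 5 * z + q ^+ 5 * (y ^+ 5 - dil 5 y) :> pser.
  have Et' : (x0%:~R : pser) ^+ 5 = x0%:~R + 5 * t%:~R.
    by rewrite -rmorphXn /= Et rmorphD rmorphM /=.
  rewrite Ex rmorphD rmorphM /= rmorph_int dil5q /z.
  by ring: Et'.
rewrite pcoefD pcoef_natM pcoefXM rpredD ?natz ?dvdz_mulr //.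
by case: ltnP => // le5n; apply: IHn; lia.
Qed.

(** First-order binomial expansion. At [i = 0] the default value of [i.-1] is harmless, as the
    factor [i] is 0. *)
Lemma exp_binomial5 x y i :
  cong 25 ((x + 5 * y) ^+ i) (x ^+ i + 5 * (i%:R * x ^+ i.-1 * y)).
Proof.
elim: i => [|i IHi]; first by rewrite !mul0r mulr0 addr0; apply: cong_refl.
rewrite exprS; apply: cong_trans (congM (cong_refl 25 (x + 5 * y)) IHi) _.
exists (i%:R * x ^+ i.-1 * y ^+ 2).
by case: i {IHi} => [|i]; rewrite /= ?exprS -?[i.+2%:R]natr1 ?expr0; ring.
Qed.

(** x^5 = V x + 5 z, and the linear term of (V x + 5 z)^5 has another factor 5. *)
Lemma frobenius25 x : cong 25 (x ^+ 25) (dil 5 (x ^+ 5)).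
Proof.
have [z Ez] := frobenius x.
have -> : x ^+ 25 = (x ^+ 5) ^+ 5 by rewrite -exprM.
rewrite rmorphXn Ez /=.
apply: cong_trans (exp_binomial5 _ _ _) _; exists (dil 5 x ^+ 4 * z) => /=.
by ring.
Qed.

Local Notation u := (dis1 A Ai).
Local Notation v := (dis2 B Bi).
Local Notation Pn := (norm1 A Ai).
Local Notation Qn := (norm2 B Bi).
Local Notation L := (lser A Ai B Bi).
Local Notation f1V := (pinv f1).
Local Notation f2V := (pinv f2).

Lemma f1K : f1 * f1V = 1. Proof. exact/pmulV/eulerP0. Qed.
Lemma f2K : f2 * f2V = 1. Proof. exact/pmulV/eulerP0. Qed.

Lemma f1_exp5 : cong 5 (f1 ^+ 5) f5.
Proof. by rewrite -dil5_f1; apply: frobenius. Qed.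
Lemma f2_exp5 : cong 5 (f2 ^+ 5) f10.
Proof. by rewrite -dil5_f2; apply: frobenius. Qed.

(** Modulo 5, V f_1 = f_1^5 = V (f_5^5 [Pn]), by [frobenius] and [dis1_exp5]; U_0 then removes V. *)
Lemma f1_norm : cong 5 f1 (f5 ^+ 5 * Pn).
Proof.
rewrite -(sec_dil0 f1) -(sec_dil0 (f5 ^+ 5 * _)); apply: sec_cong.
apply: cong_trans (cong_sym (frobenius f1)) _.
rewrite {1}f1_dissect exprMn (dis1_exp5 rAK) rmorphM rmorphXn.
by exists (dil 5 f5 ^+ 5 * rest1 A Ai); ring.
Qed.

Lemma f2_norm : cong 5 f2 (f10 ^+ 5 * Qn).
Proof.
rewrite -(sec_dil0 f2) -(sec_dil0 (f10 ^+ 5 * _)); apply: sec_cong.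
apply: cong_trans (cong_sym (frobenius f2)) _.
rewrite {1}f2_dissect exprMn (dis2_exp5 rBK) rmorphM rmorphXn.
by exists (dil 5 f10 ^+ 5 * rest2 B Bi); ring.
Qed.

(** Modulo 5, f_1 = f_5^5 [Pn] = f_1^25 [Pn]; then f_1 is cancelled. *)
Lemma norm1_f1 : cong 5 (Pn * f1 ^+ 24) 1.
Proof.
apply: (@cong_unit_cancel _ f1); first exact: eulerP0.
apply: cong_sym; rewrite mulr1; apply: cong_trans f1_norm _.
rewrite (_ : f1 * _ = f1 ^+ 5 ^+ 5 * Pn); last by ring.
by apply: congM (cong_refl _ _); apply/congX/cong_sym/f1_exp5.
Qed.

Lemma norm2_f2 : cong 5 (Qn * f2 ^+ 24) 1.
Proof.
apply: (@cong_unit_cancel _ f2); first exact: eulerP0.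
apply: cong_sym; rewrite mulr1; apply: cong_trans f2_norm _.
rewrite (_ : f2 * _ = f2 ^+ 5 ^+ 5 * Qn); last by ring.
by apply: congM (cong_refl _ _); apply/congX/cong_sym/f2_exp5.
Qed.

Lemma lser0 : L 0%N = 1.
Proof.
have E (x y : pser) : (x + q * y) 0%N = x 0%N.
  by rewrite pcoefD -[q]expr1 pcoefXM addr0.
rewrite (_ : L = B * A ^+ 3 + q * (- 3 * Ai ^+ 2 * B + Bi * (3 * A ^+ 2 + q * Ai ^+ 3)));
  last by rewrite /lser; ring.
by rewrite E pcoefM0 pcoefX0 ?rA0 // rB0.
Qed.

(* A series with constant term 1 whose cube is 1 modulo 5 is itself 1 modulo 5. *)
Lemma lser_euler : cong 5 L (f1V ^+ 8 * f2V ^+ 8).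
Proof.
pose y := L * f1 ^+ 8 * f2 ^+ 8.
have y0 : y 0%N = 1 by rewrite /y pcoefM0 (pcoefM0 L) lser0 !pcoefX0 ?eulerP0.
have [t Et] : cong 5 (y ^+ 3) 1.
  rewrite (_ : y ^+ 3 = L ^+ 3 * (f1 ^+ 24 * f2 ^+ 24)); last by rewrite /y; ring.
  apply: cong_trans (congM (lser_exp3 rAK rBK rAB) (cong_refl _ _)) _.
  rewrite (_ : _ * _ = (Pn * f1 ^+ 24) * (Qn * f2 ^+ 24)); last by ring.
  by rewrite -[X in cong _ _ X]mulr1; apply: congM norm1_f1 norm2_f2.
have [s Es] : cong 5 y 1.
  (* y^2 + y + 1 has constant term 3; doubling it and subtracting 5 makes the constant term 1, so
     the factor can be cancelled. Modulo 5 its product with y - 1 is 2 (y^3 - 1). *)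
  apply: (@cong_unit_cancel _ (2 * (y ^+ 2 + y + 1) - 5)).
    by rewrite pcoefD pcoefN pcoef_natM !pcoefD pcoefX0 // y0.
  by exists (2 * t - (y - 1)); ring: Et.
exists (s * f1V ^+ 8 * f2V ^+ 8).
transitivity (y * f1V ^+ 8 * f2V ^+ 8); first by rewrite /y; ring: f1K f2K.
by rewrite Es; ring.
Qed.

Lemma sec4_f2f1 i j :
  cong 25 (sec 4 (f2 ^+ (5 * i) * f1 ^+ (5 * j + 4)))
    (5 * (f5 ^+ 4 * (f1 ^+ j * (i%:R * f2 ^+ i.-1 * f10 ^+ 5 * L ^+ 2 -
                               (1 + 2 * i + 2 * j)%:R * f2 ^+ i)))).
Proof.
have -> : f2 ^+ (5 * i) * f1 ^+ (5 * j + 4) =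
    dil 5 (f10 ^+ (5 * i) * f5 ^+ (5 * j + 4)) *
    ((dil 5 Qn + 5 * rest2 B Bi) ^+ i * (dil 5 Pn + 5 * rest1 A Ai) ^+ j * u ^+ 4).
  rewrite -(dis1_exp5 rAK) -(dis2_exp5 rBK) {1}f1_dissect {1}f2_dissect.
  rewrite rmorphM !rmorphXn /= [(dil 5 f10 * v) ^+ _]exprMn [(dil 5 f5 * u) ^+ _]exprMn.
  by rewrite -[v ^+ 5 ^+ i]exprM -[u ^+ 5 ^+ j]exprM (exprD u); ring.
rewrite sec_dilM //.
(* Formal derivatives of [Qn ^+ i] and [Pn ^+ j]; the term containing both has a factor 25. *)
pose Q1 := i%:R * Qn ^+ i.-1 : pser; pose P1 := j%:R * Pn ^+ j.-1 : pser.
pose K2 := sec 4 (rest2 B Bi * u ^+ 4); pose K1 := sec 4 (rest1 A Ai * u ^+ 4).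
have cM : cong 25 ((dil 5 Qn + 5 * rest2 B Bi) ^+ i * (dil 5 Pn + 5 * rest1 A Ai) ^+ j * u ^+ 4)
   (dil 5 (Qn ^+ i * Pn ^+ j) * u ^+ 4 + 5 * (dil 5 (Q1 * Pn ^+ j) * (rest2 B Bi * u ^+ 4) +
     dil 5 (Qn ^+ i * P1) * (rest1 A Ai * u ^+ 4))).
  apply: cong_trans (congM (congM (exp_binomial5 _ _ _) (exp_binomial5 _ _ _)) (cong_refl _ _)) _.
  exists (dil 5 (Q1 * P1) * rest2 B Bi * rest1 A Ai * u ^+ 4).
  by rewrite /Q1 /P1 !(rmorph_nat, rmorphXn, rmorphM) /=; ring.
apply: cong_trans (congM (cong_refl _ _) (sec_cong 4 cM)) _.
have -> : sec 4 (dil 5 (Qn ^+ i * Pn ^+ j) * u ^+ 4 +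
    5 * (dil 5 (Q1 * Pn ^+ j) * (rest2 B Bi * u ^+ 4) +
         dil 5 (Qn ^+ i * P1) * (rest1 A Ai * u ^+ 4))) =
    5 * (- (Qn ^+ i * Pn ^+ j) + Q1 * Pn ^+ j * K2 + Qn ^+ i * P1 * K1).
  rewrite raddfD /= sec_natM raddfD /= !sec_dilM // (sec_dis1_exp4 rAK) //=.
  by ring.
rewrite mulrCA; apply: cong_mul5.
have cK2 : cong 5 K2 (- 2 * Qn + L ^+ 2) := sec4_rest2 rAK rBK rAB.
have cK1 : cong 5 K1 (- 2 * Pn) := sec4_rest1 rAK.
rewrite cK1 cK2.
have cF k : cong 5 (f1 ^+ k) ((f5 ^+ 5 * Pn) ^+ k) by apply/congX/f1_norm.
have cF2 k : cong 5 (f2 ^+ k) ((f10 ^+ 5 * Qn) ^+ k) by apply/congX/f2_norm.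
rewrite (cF j) (cF2 i) (cF2 i.-1) [(f5 ^+ 5 * Pn) ^+ j]exprMn.
rewrite [(f10 ^+ 5 * Qn) ^+ i]exprMn [(f10 ^+ 5 * Qn) ^+ i.-1]exprMn.
rewrite -[f5 ^+ 5 ^+ j]exprM -[f10 ^+ 5 ^+ i]exprM -[f10 ^+ 5 ^+ i.-1]exprM.
set lhs := (X in cong _ X _); set rhs := (X in cong _ _ X).
suff -> : lhs = rhs by apply: cong_refl.
have En : (1 + 2 * i + 2 * j)%:R = 1 + 2 * i%:R + 2 * j%:R :> pser.
  by rewrite natrD natrD natrM natrM.
rewrite /lhs /rhs /Q1 /P1 (exprD f5) En.
by case: i j {En cM lhs rhs Q1 P1 K1 K2 cK1 cK2} => [|i] [|j]; rewrite /= ?mulnS ?exprD ?exprS ?expr0; ring.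
Qed.

(** * The generating function of [d] *)

Lemma pinvX (x : pser) k : x 0%N = 1 -> pinv (x ^+ k) = pinv x ^+ k.
Proof.
move=> x0; apply: (@unit_mulI (x ^+ k)); first exact: pcoefX0.
by rewrite pmulV ?pcoefX0 // -exprMn pmulV // expr1n.
Qed.

Lemma d_series k : Pser (d k) = f2 ^+ k * f1V ^+ (3 * k + 1).
Proof. by rewrite -pinvX ?eulerP0 // !pexpE. Qed.

Lemma f1XK k : f1 ^+ k * f1V ^+ k = 1.
Proof. by rewrite -exprMn f1K expr1n. Qed.

Lemma expM5_cong x k : cong 5 (x ^+ (5 * k)) (dil 5 (x ^+ k)).
Proof. by rewrite exprM rmorphXn; apply/congX/frobenius. Qed.

Lemma expM25_cong x k : cong 25 (x ^+ (25 * k)) (dil 5 (x ^+ (5 * k))).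
Proof. by rewrite exprM exprM rmorphXn; apply/congX/frobenius25. Qed.

(** As 3 (25m + 16) + 1 = 5 (15m + 10) - 1, modulo 5 the series is V of a series times f_1 f_2,
    whose section 3 is f_5 f_10. Fifth powers are then absorbed in V again, and f_2^3 is left. *)
Lemma sec3_d16 m :
  cong 5 (sec 3 (Pser (d (25 * m + 16))))
    (dil 5 (f2 ^+ m * f1V ^+ (3 * m + 2) * f1 * f2) * f2 ^+ 3).
Proof.
have -> : Pser (d (25 * m + 16)) =
    f2 ^+ (5 * (5 * m + 3)) * f1V ^+ (5 * (15 * m + 10)) * (f1 * f2).
  rewrite d_series (_ : 25 * m + 16 = 5 * (5 * m + 3) + 1)%N; last by lia.
  rewrite (_ : 5 * (15 * m + 10) = 3 * (5 * (5 * m + 3) + 1) + 1 + 1)%N; last by lia.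
  by rewrite (exprD f2) (exprD f1V (_ + 1) 1) !expr1; ring: f1K.
have E : cong 5 (f2 ^+ (5 * (5 * m + 3)) * f1V ^+ (5 * (15 * m + 10)) * (f1 * f2))
     (dil 5 (f2 ^+ (5 * m + 3) * f1V ^+ (15 * m + 10)) * (f1 * f2)).
  by rewrite rmorphM; apply: congM (cong_refl _ _); apply: congM; apply: expM5_cong.
apply: cong_trans (sec_cong 3 E) _; rewrite sec_dilM //.
have -> : sec 3 (f1 * f2) = f5 * f10.
  rewrite f1_dissect f2_dissect mulrACA -rmorphM sec_dilM //.
  by rewrite (sec3_dis12 rAK rBK) mulr1.
have -> : dil 5 (f2 ^+ m * f1V ^+ (3 * m + 2) * f1 * f2) =
  dil 5 (f2 ^+ m) * dil 5 (f1V ^+ (3 * m + 2)) * f5 * f10.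
  by rewrite !rmorphM /= dil5_f1 dil5_f2.
rewrite -(expM5_cong f2 m) -(expM5_cong f1V (3 * m + 2)).
rewrite (_ : 5 * (3 * m + 2) = 15 * m + 10)%N; last by lia.
by exists 0; rewrite (exprD f2); ring.
Qed.

Lemma sec1_f2_exp3 : cong 5 (sec 1 (f2 ^+ 3)) 0.
Proof.
rewrite f2_dissect exprMn -rmorphXn sec_dilM // (sec1_dis2_exp3 rBK).
by exists (f10 ^+ 3 * q); ring.
Qed.

Lemma d16_mod5 m : cong 5 (sec 1 (sec 3 (Pser (d (25 * m + 16))))) 0.
Proof.
apply: cong_trans (sec_cong 1 (sec3_d16 m)) _; rewrite sec_dilM //.
rewrite -(mulr0 (f2 ^+ m * f1V ^+ (3 * m + 2) * f1 * f2)).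
exact: congM (cong_refl _ _) sec1_f2_exp3.
Qed.

(** Since 3 (25m + 8) + 1 = 25 (3m + 1), only f_2^8 stays outside V modulo 25. *)
Lemma d8_mod25 m : cong 25 (sec 1 (Pser (d (25 * m + 8)))) 0.
Proof.
rewrite d_series exprD (_ : 3 * (25 * m + 8) + 1 = 25 * (3 * m + 1))%N; last by lia.
have E : cong 25 (f2 ^+ (25 * m) * f2 ^+ 8 * f1V ^+ (25 * (3 * m + 1)))
    (dil 5 (f2 ^+ (5 * m) * f1V ^+ (5 * (3 * m + 1))) * f2 ^+ 8).
  by rewrite mulrAC rmorphM; apply: congM (cong_refl _ _); apply: congM; apply: expM25_cong.
apply: cong_trans (sec_cong 1 E) _; rewrite sec_dilM //.
rewrite {2}f2_dissect exprMn -rmorphXn sec_dilM // (sec1_dis2_exp8 rBK).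
exists (f2 ^+ (5 * m) * f1V ^+ (5 * (3 * m + 1)) * f10 ^+ 8 * (- 5 * q ^+ 3)).
by ring.
Qed.

(** The series is multiplied and divided by f_1^(5j+4); by the choice of [s] the denominator becomes
    f_1^(25 (3m + s)), which goes into V modulo 25, and [sec4_f2f1] treats the rest. *)
Lemma sec4_d l j s m : (5 * j + 4 + (15 * l + 1) = 25 * s)%N ->
  cong 25 (sec 4 (Pser (d (25 * m + 5 * l))))
    (5 * (dil 5 (f2 ^+ m * f1V ^+ (3 * m + s) * f1 ^+ 4) *
          (f1 ^+ j * (l%:R * f2 ^+ l.-1 * f10 ^+ 5 * L ^+ 2 - (1 + 2 * l + 2 * j)%:R * f2 ^+ l)))).
Proof.
move=> Es; set Y := f1 ^+ j * _.
have -> : Pser (d (25 * m + 5 * l)) =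
    f2 ^+ (25 * m) * f1V ^+ (25 * (3 * m + s)) * (f2 ^+ (5 * l) * f1 ^+ (5 * j + 4)).
  rewrite d_series (exprD f2).
  rewrite (_ : 25 * (3 * m + s) = 5 * j + 4 + (3 * (25 * m + 5 * l) + 1))%N; last by lia.
  by rewrite (exprD f1V (5 * j + 4)); ring: (f1XK (5 * j + 4)).
have E : cong 25 (f2 ^+ (25 * m) * f1V ^+ (25 * (3 * m + s)) * (f2 ^+ (5 * l) * f1 ^+ (5 * j + 4)))
    (dil 5 (f2 ^+ (5 * m) * f1V ^+ (5 * (3 * m + s))) * (f2 ^+ (5 * l) * f1 ^+ (5 * j + 4))).
  by rewrite rmorphM; apply: congM (cong_refl _ _); apply: congM; apply: expM25_cong.
apply: cong_trans (sec_cong 4 E) _; rewrite sec_dilM //.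
apply: cong_trans (congM (cong_refl _ _) (sec4_f2f1 l j)) _.
rewrite -/Y mulrCA; apply: cong_mul5.
rewrite 2!rmorphM /= -(expM5_cong f2 m) -(expM5_cong f1V (3 * m + s)) rmorphXn /= dil5_f1 mulrA.
exact: cong_refl.
Qed.

Lemma sec_d l j s m r : (5 * j + 4 + (15 * l + 1) = 25 * s)%N -> (r < 5)%N ->
  cong 5 (sec r (f1 ^+ j * (l%:R * f2 ^+ l.-1 * f10 ^+ 5 * L ^+ 2 -
                           (1 + 2 * l + 2 * j)%:R * f2 ^+ l))) 0 ->
  cong 25 (sec r (sec 4 (Pser (d (25 * m + 5 * l))))) 0.
Proof.
move=> Es lt_r5 cY; apply: cong_trans (sec_cong r (sec4_d m Es)) _.
rewrite sec_natM sec_dilM //.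
set k := f2 ^+ m * _ * _; have := cong_mul5 (congM (cong_refl 5 k) cY).
by rewrite [k * 0]mulr0 [5 * 0]mulr0.
Qed.

(** * The cases k = 0, 5 and 10 *)

Lemma sec4_f1_exp4 : sec 4 (f1 ^+ 4) = - 5 * f5 ^+ 4.
Proof.
rewrite {1}f1_dissect exprMn -rmorphXn sec_dilM // (sec_dis1_exp4 rAK) //=.
by ring.
Qed.

(** With l = 0 the term in L disappears; a multiple of f_1^4 is left, whose section 4 is divisible
    by 5. *)
Lemma d0_mod25 m : cong 25 (sec 4 (sec 4 (Pser (d (25 * m + 5 * 0))))) 0.
Proof.
apply: (@sec_d 0 4 1) => //.
have -> : f1 ^+ 4 * (0 * f2 ^+ 0.-1 * f10 ^+ 5 * L ^+ 2 - (1 + 2 * 0 + 2 * 4)%:R * f2 ^+ 0) =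
  - (9 * f1 ^+ 4) by ring.
rewrite raddfN /= sec_natM sec4_f1_exp4.
by exists (9 * f5 ^+ 4); ring.
Qed.

Lemma sec3_f2_exp4 : sec 3 (f2 ^+ 4) = - 5 * q * f10 ^+ 4.
Proof.
rewrite {1}f2_dissect exprMn -rmorphXn sec_dilM // (sec3_dis2_exp4 rBK).
by ring.
Qed.

Lemma f10_exp5 : f10 ^+ 5 = dil 5 (f2 ^+ 5). Proof. by rewrite rmorphXn /= dil5_f2. Qed.

(** Here 1 + 2l + 2j = 5, so modulo 5 only the term in L^2 survives; by [lser_euler] it is f_10^5
    f_1^(-15) f_2^(-16), that is, V of a series times f_2^4. *)
Lemma d5_mod25 m : cong 25 (sec 3 (sec 4 (Pser (d (25 * m + 5 * 1))))) 0.
Proof.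
apply: (@sec_d 1 1 1) => //; set Y := (X in sec 3 X).
suff cY : cong 5 Y (dil 5 (f2 ^+ 5 * (f1V ^+ 3 * f2V ^+ 4)) * f2 ^+ 4).
  apply: cong_trans (sec_cong 3 cY) _; rewrite sec_dilM // sec3_f2_exp4.
  by exists (- (f2 ^+ 5 * (f1V ^+ 3 * f2V ^+ 4)) * q * f10 ^+ 4); ring.
have -> : Y = f10 ^+ 5 * (f1 * L ^+ 2) + 5 * (- f1 * f2) by rewrite /Y; ring.
rewrite (rmorphM _ (f2 ^+ 5)) /= -f10_exp5 rmorphM /= -(expM5_cong f1V 3) -(expM5_cong f2V 4).
rewrite lser_euler; exists (- f1 * f2).
by congr (_ + _); ring: f1K f2K.
Qed.

(** Here 1 + 2l + 2j = 11 is 1 modulo 5. The term in L^2 becomes twice V of a series times f_1^2,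
    while section 2 of f_1^3 f_2^2 brings back L; the two contributions are 2 f_5^2 f_2^2 / f_1^3
    with opposite signs. *)
Lemma d10_mod25 m : cong 25 (sec 2 (sec 4 (Pser (d (25 * m + 5 * 2))))) 0.
Proof.
apply: (@sec_d 2 3 2) => //; set Y := (X in sec 2 X).
suff cY : cong 5 Y (2 * (dil 5 (f2 ^+ 5 * (f1V ^+ 3 * f2V ^+ 3)) * f1 ^+ 2) - f1 ^+ 3 * f2 ^+ 2).
  apply: cong_trans (sec_cong 2 cY) _.
  rewrite raddfB /= sec_natM sec_dilM //.
  have -> : sec 2 (f1 ^+ 2) = - f5 ^+ 2.
    by rewrite {1}f1_dissect exprMn -rmorphXn sec_dilM // (sec2_dis1_exp2 rAK); ring.
  have -> : sec 2 (f1 ^+ 3 * f2 ^+ 2) = f5 ^+ 3 * f10 ^+ 2 * (- 2 * L - 5 * q).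
    rewrite {1}f1_dissect {1}f2_dissect !exprMn mulrACA -!rmorphXn -rmorphM sec_dilM //.
    by rewrite (sec2_dis12_exp32 rAK rBK).
  have E : cong 5 (f5 * f10 ^+ 2 * L) (f2 ^+ 2 * f1V ^+ 3).
    rewrite lser_euler -f1_exp5 -f2_exp5.
    set lhs := (X in cong _ X _); suff -> : lhs = f2 ^+ 2 * f1V ^+ 3 by apply: cong_refl.
    by rewrite /lhs; ring: f1K f2K.
  have [t Et] := E.
  by exists (2 * f5 ^+ 2 * t + f5 ^+ 3 * f10 ^+ 2 * q); ring: Et f2K.
have -> : Y = 2 * (f10 ^+ 5 * (f1 ^+ 3 * f2 * L ^+ 2)) - f1 ^+ 3 * f2 ^+ 2 +
  5 * (- 2 * f1 ^+ 3 * f2 ^+ 2) by rewrite /Y /=; ring.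
rewrite (rmorphM _ (f2 ^+ 5)) /= -f10_exp5 rmorphM /= -(expM5_cong f1V 3) -(expM5_cong f2V 3).
rewrite lser_euler; exists (- 2 * f1 ^+ 3 * f2 ^+ 2).
by congr (_ + _); ring: f1K f2K.
Qed.

Lemma cong0_mod k (x : pser) n : (0 < k)%N -> cong k%:R x 0 -> (x n = 0 %[mod k%:Z])%Z.
Proof.
move=> k0 /(cong_natP _ _ k0)/(_ n).
by rewrite subr0 => /dvdz_mod0P ->; rewrite mod0z.
Qed.

Local Close Scope ring_scope.

Theorem theorem1p2 (c n : nat) :
  [/\ (d (25 * c + 16) (25 * n + 8) = 0 %[mod 5])%Z,
      (d (25 * c + 8) (5 * n + 1) = 0 %[mod 25])%Z &
      forall k : nat, k \in [:: 0; 5; 10] ->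
        (d (25 * c + k) (25 * n + 24 - k) = 0 %[mod 25])%Z].
Proof.
split; last (move=> k; rewrite !inE => /or3P[] /eqP->).
- have := @cong0_mod 5 _ n isT (d16_mod5 c); rewrite /=.
  by rewrite (_ : 5 * (5 * n + 1) + 3 = 25 * n + 8)%N //; lia.
- exact: @cong0_mod 25 _ n isT (d8_mod25 c).
- have := @cong0_mod 25 _ n isT (d0_mod25 c); rewrite /=.
  by rewrite (_ : 5 * (5 * n + 4) + 4 = 25 * n + 24 - 0)%N //; lia.
- have := @cong0_mod 25 _ n isT (d5_mod25 c); rewrite /=.
  by rewrite (_ : 5 * (5 * n + 3) + 4 = 25 * n + 24 - 5)%N //; lia.
have := @cong0_mod 25 _ n isT (d10_mod25 c); rewrite /=.
by rewrite (_ : 5 * (5 * n + 2) + 4 = 25 * n + 24 - 10)%N //; lia.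
Qed.
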